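(* Let $(M,A,g,F)$ be an almost para-Hermitian manifold with K\''ahler 2-form $F$, considered as a generalized Riemannian manifold $(M,G=g+F)$. Then there is a linear connection $\nabla$ on $(M,G)$ satisfying the Einstein metricity condition with totally skew-symmetric torsion $T$ if and only if the Nijenhuis tensor $N$ of $A$ is totally skew-symmetric, i.e. $N(X,Y,Z)=-N(X,Z,Y)$. The skew-symmetric torsion is determined by $T(X,Y,Z)=-\frac13dF(X,Y,Z)$, the Einstein metricity condition has the form $(\nabla_XG)(Y,Z)=\frac13\big[dF(X,Y,Z)-dF(X,Y,AZ)\big]$, and the following equalities hold (with $A^2=1$): $$(\nabla_Xg)(Y,Z)=-\tfrac16\big[dF(X,Y,AZ)-dF(X,AY,Z)\big],\qquad (\nabla_XF)(Y,Z)=\tfrac16\big[2dF(X,Y,Z)-dF(X,Y,AZ)-dF(X,AY,Z)\big],$$ $$g(\nabla_XY,Z)=g(\nabla^g_XY,Z)-\tfrac16dF(X,Y,Z)-\tfrac16dF(X,AY,Z)+\tfrac16dF(AX,Y,Z),$$ $$(\nabla^g_XF)(Y,Z)=g((\nabla^g_XA)Y,Z)=\tfrac13dF(X,Y,Z)+\tfrac13dF(X,AY,AZ)-\tfrac16dF(AX,Y,AZ)-\tfrac16dF(AX,AY,Z).$$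
   Context: An almost para-Hermitian manifold $(M,g,A)$ is a pseudo-Riemannian manifold with an endomorphism field $A$ satisfying $A^2=I$ and $g(AX,AY)=-g(X,Y)$; then $\dim M=2n$, the $\pm1$-eigensubbundles of $A$ both have dimension $n$ and $g$ has neutral signature $(n,n)$. Its K\''ahler 2-form is $F(X,Y)=g(AX,Y)$. Let $\nabla^g$ be the Levi-Civita connection of $g$. The torsion of $\nabla$ is $T(X,Y)=\nabla_XY-\nabla_YX-[X,Y]$, with $T(X,Y,Z)=g(T(X,Y),Z)$; it is totally skew-symmetric if $T(X,Y,Z)=-T(X,Z,Y)$. For $G=g+F$, a linear connection $\nabla$ satisfies the Einstein metricity condition if $XG(Y,Z)-G(\nabla_YX,Z)-G(Y,\nabla_XZ)=0$ for commuting vector fields $X,Y,Z$, equivalently $(\nabla_XG)(Y,Z)=-G(T(X,Y),Z)$. The Nijenhuis tensor of $A$ is $N(X,Y)=[AX,AY]+A^2[X,Y]-A[AX,Y]-A[X,AY]$, with $N(X,Y,Z)=g(N(X,Y),Z)$. The exterior derivative is normalized so that for commuting vector fields $dF(X,Y,Z)=XF(Y,Z)+YF(Z,X)+ZF(X,Y)$. Tensor identities hold for all vector fields $X,Y,Z$. *)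

(* Defs.v *)
From HB Require Import structures.
From mathcomp Require Import all_boot all_order all_algebra.
From mathcomp Require Import ring.
From mathcomp Require Import all_classical all_reals all_analysis.

Set Implicit Arguments.
Unset Strict Implicit.
Unset Printing Implicit Defensive.

Import Order.TTheory GRing.Theory Num.Theory.
Import numFieldNormedType.Exports.

Local Open Scope classical_set_scope.
Local Open Scope ring_scope.

(* [Ck_on k U f] is meant for open [U]: class C^(k+1) means Frechet
   differentiable with all directional derivatives of class C^k. *)
Fixpoint Ck_on (R : realType) (V W : normedModType R) (k : nat) (U : set V)
    (f : V -> W) {struct k} : Prop :=
  match k with
  | 0 => forall x, U x -> {for x, continuous f}
  | k'.+1 => (forall x, U x -> differentiable f x) /\
             forall v, Ck_on k' U ('D_v f)
  end.

Definition smooth_on (R : realType) (V W : normedModType R) (U : set V)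
    (f : V -> W) : Prop :=
  forall k, Ck_on k U f.

Section SmoothOn.
Variables (R : realType) (V : normedModType R).

Lemma near_eq_differentiable (W : normedModType R) (f g : V -> W) (x : V) :
  {near x, f =1 g} -> differentiable f x -> differentiable g x.
Proof.
move=> fg /diff_locallyP [cf df].
suff gE : g \o shift x = cst (g x) + 'd f x +o_ 0 id.
  by apply/diff_locallyP; rewrite (diff_unique cf gE).
apply/eqaddoP => _/posnumP[e].
have /eqaddoP/(_ e%:num) Hf := df.
have fg0 : \forall h \near 0, f (h + x) = g (h + x).
  by move: fg; rewrite (near_shift 0 x) /=; apply: filterS => h /=; rewrite subr0.
near=> h.
have -> : (g \o shift x - (cst (g x) + 'd f x)) h =
          (f \o shift x - (cst (f x) + 'd f x)) h.
  rewrite -[LHS]/(g (h + x) - (g x + 'd f x h)) -(nbhs_singleton fg).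
  by rewrite -(near fg0 h).
by near: h; exact: Hf.
Unshelve. all: by end_near. Qed.

Lemma Ck_onW (W : normedModType R) k (U : set V) (f : V -> W) :
  Ck_on k.+1 U f -> Ck_on k U f.
Proof.
elim: k f => [|k IH] f [df Df].
  by move=> x /df /differentiable_continuous.
by split=> // v; exact/IH/Df.
Qed.

Lemma Ck_on_eq (W : normedModType R) k (U : set V) (f g : V -> W) :
  open U -> (forall x, U x -> f x = g x) -> Ck_on k U f -> Ck_on k U g.
Proof.
move=> oU; elim: k f g => [|k IH] f g fg.
  move=> cf x Ux; rewrite /prop_for /continuous_at -fg//.
  apply: cvg_trans (cf _ Ux); apply: near_eq_cvg.
  by near=> y; apply: fg; near: y; apply: open_nbhs_nbhs.
move=> [df Df]; split=> [x Ux|v].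
  apply: near_eq_differentiable (df _ Ux).
  by near=> y; apply: fg; near: y; apply: open_nbhs_nbhs.
apply: (IH ('D_v f)); last exact: Df.
move=> x Ux; apply: near_eq_derive.
by near=> y; apply: fg; near: y; apply: open_nbhs_nbhs.
Unshelve. all: by end_near. Qed.

Lemma Ck_on_cst (W : normedModType R) k (U : set V) (a : W) :
  Ck_on k U (cst a).
Proof.
elim: k a => [|k IH] a; first by move=> x _; exact: cst_continuous.
split=> [x _|v]; first exact: differentiable_cst.
suff -> : 'D_v (cst a) = cst 0 :> (V -> W) by [].
by apply/funext => x; rewrite derive_cst.
Qed.

Lemma Ck_onD (W : normedModType R) k (U : set V) (f g : V -> W) : open U ->
  Ck_on k U f -> Ck_on k U g -> Ck_on k U (f + g).
Proof.
move=> oU; elim: k f g => [|k IH] f g.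
  by move=> cf cg x Ux; apply: continuousD; [exact: cf|exact: cg].
move=> [df Df] [dg Dg]; split=> [x Ux|v].
  by apply: differentiableD; [exact: df|exact: dg].
apply: (@Ck_on_eq _ _ _ ('D_v f + 'D_v g)) => //;
  last by apply: IH; [exact: Df|exact: Dg].
move=> x Ux.
by rewrite deriveD//; [exact/diff_derivable/df|exact/diff_derivable/dg].
Qed.

Lemma Ck_onZ (W : normedModType R) k (U : set V) (a : R) (f : V -> W) :
  open U -> Ck_on k U f -> Ck_on k U (a *: f).
Proof.
move=> oU; elim: k f => [|k IH] f.
  by move=> cf x Ux; apply: (@continuousZl_tmp _ _ _ f a x); exact: cf.
move=> [df Df]; split=> [x Ux|v].
  by apply: differentiableZ; exact: df.
apply: (@Ck_on_eq _ _ _ (a *: 'D_v f)) => //; last exact/IH/Df.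
by move=> x Ux; rewrite deriveZ//; exact/diff_derivable/df.
Qed.

Lemma Ck_onM k (U : set V) (f g : V -> R) : open U ->
  Ck_on k U f -> Ck_on k U g -> Ck_on k U (f * g).
Proof.
move=> oU; elim: k f g => [|k IH] f g.
  by move=> cf cg x Ux; apply: continuousM; [exact: cf|exact: cg].
move=> Ckf Ckg; have [df Df] := Ckf; have [dg Dg] := Ckg.
split=> [x Ux|v].
  by apply: differentiableM; [exact: df|exact: dg].
apply: (@Ck_on_eq _ _ _ (f * 'D_v g + g * 'D_v f)) => //.
  move=> x Ux.
  by rewrite deriveM//; [exact/diff_derivable/df|exact/diff_derivable/dg].
by apply: Ck_onD => //; apply: IH => //; exact: Ck_onW || exact: Df || exact: Dg.
Qed.

End SmoothOn.

(* Charts are total functions; only [chart_dom] and its image matter. *)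
Record chart (R : realType) (m : nat) (M : topologicalType) := Chart {
  chart_dom : set M;
  chart_map : M -> 'rV[R]_m;
  chart_inv : 'rV[R]_m -> M;
  chart_dom_open : open chart_dom;
  chart_cod_open : open (chart_map @` chart_dom);
  chart_mapK : forall p, chart_dom p -> chart_inv (chart_map p) = p;
  chart_map_continuous : {within chart_dom, continuous chart_map};
  chart_inv_continuous :
    {within chart_map @` chart_dom, continuous chart_inv}
}.

Arguments chart_dom_open {R m M} c.
Arguments chart_cod_open {R m M} c.

Record smoothManifold (R : realType) (m : nat) := SmoothManifold {
  mfd_space :> topologicalType;
  mfd_hausdorff : hausdorff_space mfd_space;
  mfd_second_countable : @second_countable mfd_space;
  mfd_atlas : set (chart R m mfd_space);
  mfd_cover : forall p, exists2 c, mfd_atlas c & chart_dom c p;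
  mfd_compat : forall c d, mfd_atlas c -> mfd_atlas d ->
    smooth_on (chart_map c @` (chart_dom c `&` chart_dom d))
              (chart_map d \o chart_inv c)
}.

Section SmoothFunctions.
Variables (R : realType) (m : nat) (M : smoothManifold R m).

Definition smooth_function (f : M -> R) : Prop :=
  forall c, mfd_atlas c ->
    smooth_on (chart_map c @` chart_dom c) (f \o chart_inv c).

Definition smooth_function_pred : {pred M -> R} :=
  [pred f | `[< smooth_function f >]].

Record smoothfun := SmoothFun {
  smoothfun_val :> M -> R;
  _ : smoothfun_val \in smooth_function_pred
}.

HB.instance Definition _ := [isSub for smoothfun_val].
HB.instance Definition _ := [Choice of smoothfun by <:].

Lemma smooth_function_subring : subring_closed smooth_function_pred.
Proof.
split=> [|f g|f g].
- by apply/asboolP => c ac k; exact: Ck_on_cst.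
- move=> /asboolP sf /asboolP sg; apply/asboolP => c ac k.
  have oc := chart_cod_open c.
  apply: (@Ck_on_eq _ _ _ _ _ (f \o chart_inv c + (- 1) *: (g \o chart_inv c))).
  + by [].
  + by move=> x _; rewrite scaleN1r.
  + by apply: Ck_onD => //; [exact: sf|apply: Ck_onZ => //; exact: sg].
- move=> /asboolP sf /asboolP sg; apply/asboolP => c ac k.
  have oc := chart_cod_open c.
  apply: (@Ck_on_eq _ _ _ _ _ ((f \o chart_inv c) * (g \o chart_inv c))) => //.
  by apply: Ck_onM => //; [exact: sf|exact: sg].
Qed.

HB.instance Definition _ :=
  GRing.isSubringClosed.Build (M -> R) smooth_function_pred
    smooth_function_subring.

HB.instance Definition _ :=
  GRing.SubChoice_isSubComPzRing.Build _ _ smoothfun (subringClosedP _).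

Lemma smooth_function_scaler : GRing.scaler_closed smooth_function_pred.
Proof.
move=> a f /asboolP sf; apply/asboolP => c ac k.
have oc := chart_cod_open c.
apply: (@Ck_on_eq _ _ _ _ _ (a *: (f \o chart_inv c))) => //.
by apply: Ck_onZ => //; exact: sf.
Qed.

HB.instance Definition _ :=
  GRing.isScaleClosed.Build R (M -> R) smooth_function_pred
    smooth_function_scaler.

HB.instance Definition _ := [SubZmodule_isSubLmodule of smoothfun by <:].

End SmoothFunctions.

(* Vector fields are the derivations of the algebra of smooth functions: the
   vector [X_p] is the functional [fun f => X f p]. *)
Section VectorFields.
Variables (R : realType) (m : nat) (M : smoothManifold R m).
Local Notation C := (smoothfun M).

Definition derivation (D : C -> C) : Prop :=
  (forall (a : R) (f g : C), D (a *: f + g) = a *: D f + D g) /\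
  (forall f g : C, D (f * g) = D f * g + f * D g).

Definition derivation_pred : {pred C -> C^o} :=
  [pred D | `[< derivation D >]].

Record vfield := VField {
  vfield_val : C -> C^o;
  _ : vfield_val \in derivation_pred
}.

HB.instance Definition _ := [isSub for vfield_val].
HB.instance Definition _ := [Choice of vfield by <:].

Lemma derivation_submod : GRing.submod_closed derivation_pred.
Proof.
split=> [|h D E /asboolP[DL DM] /asboolP[EL EM]]; apply/asboolP.
  by split=> [a f g|f g]; rewrite /= ?scaler0 ?mul0r ?mulr0 addr0.
have e f : (h *: D + E) f = (h * D f + E f :> C) by [].
split=> [a f g|f g]; rewrite !e ?DL ?EL ?DM ?EM.
  rewrite mulrDr scalerDr addrACA; congr (_ + _ + _).
  by apply/val_inj/funext => p; rewrite /= !fctE; exact: mulrCA.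
rewrite !mulrDr !mulrDl addrACA.
by congr (_ + _ + (_ + _)); [exact: mulrA|exact: mulrCA].
Qed.

HB.instance Definition _ :=
  GRing.isSubmodClosed.Build C (C -> C^o) derivation_pred
    derivation_submod.
HB.instance Definition _ := [SubChoice_isSubLmodule of vfield by <:].

(* [vfield_val] lands in [C^o] only to provide the module structure. *)
Definition vfield_app (X : vfield) : C -> C := vfield_val X.
Coercion vfield_app : vfield >-> Funclass.

Lemma vfieldP (X : vfield) : derivation X.
Proof. exact/asboolP/(valP X). Qed.

Lemma lie_subproof (X Y : vfield) :
  ((fun f => X (Y f) - Y (X f)) : C -> C^o) \in derivation_pred.
Proof.
have [XL XM] := vfieldP X; have [YL YM] := vfieldP Y.
apply/asboolP; split=> [a f g|f g].
  by rewrite YL !XL YL scalerBr opprD addrACA.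
have XD u v : X (u + v) = X u + X v by rewrite -[u]scale1r XL !scale1r.
have YD u v : Y (u + v) = Y u + Y v by rewrite -[u]scale1r YL !scale1r.
rewrite YM XM XD YD !XM !YM.
move: (X (Y f)) (Y (X f)) (X (Y g)) (Y (X g)) => a b c d.
move: (X f) (X g) (Y f) (Y g) => x x' y y'.
by ring.
Qed.

Definition lie (X Y : vfield) : vfield := VField (lie_subproof X Y).

End VectorFields.

Section Geometry.
Variables (R : realType) (m : nat) (M : smoothManifold R m).
Local Notation C := (smoothfun M).
Local Notation X := (vfield M).

Definition endomorphism_field (A : X -> X) : Prop :=
  forall (f : C) U V, A (f *: U + V) = f *: A U + A V.

Definition covariant2 (B : X -> X -> C) : Prop :=
  (forall (f : C) U V W, B (f *: U + V) W = f * B U W + B V W) /\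
  (forall (f : C) U V W, B W (f *: U + V) = f * B W U + B W V).

(* Nondegeneracy is pointwise: if [g_p(U_p, -) = 0] then [U_p = 0]. *)
Record pseudo_riemannian (g : X -> X -> C) : Prop := PseudoRiemannian {
  pr_tensor : covariant2 g;
  pr_sym : forall U V, g U V = g V U;
  pr_nondegenerate : forall (p : M) (U : X),
    (forall V, g U V p = 0) -> forall f : C, U f p = 0
}.

Record almost_para_hermitian (A : X -> X) (g : X -> X -> C) : Prop :=
  AlmostParaHermitian {
    aph_metric : pseudo_riemannian g;
    aph_tensor : endomorphism_field A;
    aph_invol : forall U, A (A U) = U;
    aph_compat : forall U V, g (A U) (A V) = - g U V
  }.

Definition kahler_form (A : X -> X) (g : X -> X -> C) (U V : X) : C :=
  g (A U) V.

Definition gen_metric (A : X -> X) (g : X -> X -> C) (U V : X) : C :=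
  g U V + kahler_form A g U V.

Record linear_connection (nab : X -> X -> X) : Prop := LinearConnection {
  conn_linearl : forall (f : C) U V W,
    nab (f *: U + V) W = f *: nab U W + nab V W;
  conn_addr : forall U V W, nab U (V + W) = nab U V + nab U W;
  conn_leibniz : forall (f : C) U V,
    nab U (f *: V) = U f *: V + f *: nab U V
}.

Definition torsion (nab : X -> X -> X) (U V : X) : X :=
  nab U V - nab V U - lie U V.

Definition nabla2 (nab : X -> X -> X) (B : X -> X -> C) (U V W : X) : C :=
  U (B V W) - B (nab U V) W - B V (nab U W).

Definition nabla_endo (nab : X -> X -> X) (A : X -> X) (U V : X) : X :=
  nab U (A V) - A (nab U V).

Definition nijenhuis (A : X -> X) (U V : X) : X :=
  lie (A U) (A V) + A (A (lie U V)) - A (lie (A U) V) - A (lie U (A V)).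

Definition lower (g : X -> X -> C) (T : X -> X -> X) (U V W : X) : C :=
  g (T U V) W.

Definition totally_skew (g : X -> X -> C) (T : X -> X -> X) : Prop :=
  forall U V W, lower g T U V W = - lower g T U W V.

(* The bracket terms vanish for commuting fields; no factor 1/3. *)
Definition ext_d (F : X -> X -> C) (U V W : X) : C :=
  (U (F V W) + V (F W U) + W (F U V))
  - (F (lie U V) W + F (lie V W) U + F (lie W U) V).

(* For pairwise commuting fields this reads
   [U (G V W) - G (nab V U) W - G V (nab U W) = 0]; the tensorial form is used
   because globally defined commuting fields need not be plentiful. *)
Definition einstein_metricity (G : X -> X -> C) (nab : X -> X -> X) : Prop :=
  forall U V W, nabla2 nab G U V W = - G (torsion nab U V) W.

Definition levi_civita (g : X -> X -> C) (nab : X -> X -> X) : Prop :=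
  [/\ linear_connection nab,
      forall U V W, nabla2 nab g U V W = 0 &
      forall U V, torsion nab U V = 0].

End Geometry.

(* Main.v *)
From HB Require Import structures.
Require Import Defs.
From mathcomp Require Import all_boot all_order all_algebra.
From mathcomp Require Import ring lra.
From mathcomp Require Import all_classical all_reals all_analysis.

(** Write nab for the sought connection, T for its torsion lowered by g, and
    nabg for the Levi-Civita connection.

    Uniqueness is linear algebra.  Since A is g-skew, the metricity condition
    reads (nab_U G)(V, W) = T(U, V, A W) - T(U, V, W).  Its symmetric part in
    (V, W) is nab g and its skew part is nab F, so both are explicit in T
    ([einstein_nabla2_metric], [einstein_nabla2_kahler]).  Writing dF through
    nab and T then collapses to dF = - 3 T ([einstein_torsion]), and expressing
    the Nijenhuis tensor through nab A and T gives
      N(U, V, W) = - T(A U, V, W) - T(U, A V, W) - T(U, V, A W)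
                   - T(A U, A V, A W),
    which is totally skew ([einstein_nijenhuis]).  The difference nab - nabg is
    found from its skew part in the first two slots (the torsion) and its
    symmetric part in the last two (nab g), as in Koszul's formula
    ([difference_formula]).

    Existence reverses this: add to nabg the tensor S that uniqueness dictates.
    The torsion of nabg + S is always - dF / 3; metricity amounts to the stated
    formula for nabg A in terms of dF, and that formula holds as soon as N is
    totally skew ([skew_nijenhuis_nabla_endo]): with a(U, V, W) =
    g((nabg_U A) V, W), skewness of N says exactly that
    c(U, V, W) = a(A U, V, W) + a(U, V, A W) is totally skew, and the
    formula is the resulting cyclic symmetry of c.

    The analytic content is that nabg and S exist at all: a C^oo-linear form
    alpha on vector fields must be g(U, -) for a vector field U ([riesz]).
    Because vector fields are derivations of the algebra of smooth functions,
    this needs that a derivation is locally a combination of coordinate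
    fields, which rests on Hadamard's lemma with smooth remainders
    ([hadamard]) and on bump functions ([bump_exists]) extending local
    functions to M.  Divisions are avoided until the very end: near each point
    one has only w X = sum_i xi_i(X) E_i with w nonzero at the point
    ([local_frame]); Cramer's rule over the ring of smooth functions then
    solves g(U, -) = w alpha, and U / w glues because nondegeneracy makes it
    independent of the point. *)

Set Implicit Arguments.
Unset Strict Implicit.
Unset Printing Implicit Defensive.

Import Order.TTheory GRing.Theory Num.Theory.
Import numFieldNormedType.Exports.
Local Open Scope classical_set_scope.
Local Open Scope ring_scope.

(** * Calculus of C^k functions *)

Section CkOn.
Variables (R : realType) (V : normedModType R).

Lemma Ck_on_continuous (W : normedModType R) k (U : set V) (f : V -> W) x :
  Ck_on k U f -> U x -> {for x, continuous f}.
Proof. by elim: k => [|k IH] cf; [exact: cf|apply: IH; exact: Ck_onW]. Qed.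

Lemma Ck_on_sub (W : normedModType R) k (U U' : set V) (f : V -> W) :
  U' `<=` U -> Ck_on k U f -> Ck_on k U' f.
Proof.
move=> sU; elim: k f => [|k IH] f; first by move=> cf x /sU; exact: cf.
by move=> [df Df]; split=> [x /sU|v]; [exact: df|exact/IH/Df].
Qed.

Lemma Ck_on_local (W : normedModType R) k (U : set V) (f : V -> W) :
  (forall x, U x -> exists U', U' x /\ Ck_on k U' f) -> Ck_on k U f.
Proof.
elim: k f => [|k IH] f lf.
  by move=> x /lf[U' [U'x cf]]; exact: cf.
split=> [x /lf[U' [U'x [df _]]]|v]; first exact: df.
apply: IH => x /lf[U' [U'x [_ Df]]]; by exists U'; split=> //; exact: Df.
Qed.

Lemma Ck_onN (W : normedModType R) k (U : set V) (f : V -> W) : open U ->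
  Ck_on k U f -> Ck_on k U (- f).
Proof. by move=> oU cf; rewrite -scaleN1r; exact: Ck_onZ. Qed.

Lemma Ck_onB (W : normedModType R) k (U : set V) (f g : V -> W) : open U ->
  Ck_on k U f -> Ck_on k U g -> Ck_on k U (f - g).
Proof. by move=> oU cf cg; apply: Ck_onD => //; exact: Ck_onN. Qed.

Lemma Ck_on_sum (W : normedModType R) k (U : set V) n (f : 'I_n -> V -> W) :
  open U -> (forall i, Ck_on k U (f i)) -> Ck_on k U (\sum_i f i).
Proof.
move=> oU cf; elim/big_ind: _ => //; first exact: (@Ck_on_cst _ _ _ _ _ 0).
by move=> ? ?; exact: Ck_onD.
Qed.

Lemma Ck_onV k (U : set V) (f : V -> R) : open U ->
  (forall x, U x -> f x != 0) -> Ck_on k U f -> Ck_on k U (fun x => (f x)^-1).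
Proof.
move=> oU f0; elim: k => [|k IH].
  by move=> cf x Ux; apply: (@continuousV _ _ f); [exact: f0|exact: cf].
move=> Cf; have [df Df] := Cf.
split=> [x Ux|v].
  by apply: (@differentiableV _ _ f); [exact: df|exact: f0].
have CVk : Ck_on k U (fun x => (f x)^-1) by apply/IH/Ck_onW.
apply: (@Ck_on_eq _ _ _ _ _ ((fun x => (f x)^-1) * (fun x => (f x)^-1) *
   (- 'D_v f))) => //; last first.
  by apply: Ck_onM => //; [exact: Ck_onM|apply: Ck_onN => //; exact: Df].
move=> x Ux; rewrite deriveV; [|exact: f0|exact/diff_derivable/df].
by rewrite !fctE /GRing.scale /= expr2 invfM mulrN mulNr.
Qed.

Lemma Ck_on_linear_comp (W W' : normedModType R) k (U : set V) (f : V -> W)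
    (L : {linear W -> W'}) : open U -> continuous L ->
  Ck_on k U f -> Ck_on k U (L \o f).
Proof.
move=> oU cL; elim: k f => [|k IH] f.
  move=> cf x Ux; apply: continuous_comp; [exact: cf|exact: cL].
move=> [df Df]; have dL y : differentiable L y by exact: linear_differentiable.
split=> [x Ux|v]; first by apply: differentiable_comp => //; exact: df.
apply: (@Ck_on_eq _ _ _ _ _ (L \o 'D_v f)) => //; last exact/IH/Df.
move=> x Ux /=.
rewrite [RHS]deriveE; last by apply: differentiable_comp => //; exact: df.
rewrite diff_comp //; last exact: df.
by rewrite /= diff_lin // deriveE //; exact: df.
Qed.

End CkOn.

(** The chain rule closes on the class C^k only when the derivative of the outer
    function splits into finitely many partial derivatives, so the middle space
    carries a finite dual basis; it is used for R and for row vectors. *)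
Section Chain.
Variables (R : realType) (V W W' : normedModType R) (n : nat).
Variables (e : 'I_n -> W) (l : 'I_n -> {linear W -> R}).
Hypothesis cl : forall i, continuous (l i).
Hypothesis el : forall w, w = \sum_i l i w *: e i.

Lemma Ck_on_comp_coord k (U : set V) (U' : set W) (f : V -> W) (g : W -> R) :
  open U -> (forall x, U x -> U' (f x)) ->
  Ck_on k U f -> Ck_on k U' g -> Ck_on k U (g \o f).
Proof.
move=> oU fU; elim: k f g fU => [|k IH] f g fU.
  move=> cf cg x Ux; apply: continuous_comp; [exact: cf|exact/cg/fU].
move=> Cf Cg; have [df Df] := Cf; have [dg Dg] := Cg.
have dgf x : U x -> differentiable (g \o f) x.
  by move=> Ux; apply: differentiable_comp; [exact: df|exact/dg/fU].
split=> // v.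
apply: (@Ck_on_eq _ _ _ _ _
   (\sum_i (l i \o 'D_v f) * ('D_(e i) g \o f))) => //; last first.
  apply: Ck_on_sum => // i; apply: Ck_onM => //.
    by apply: Ck_on_linear_comp => //; exact: Df.
  by apply: IH => //; [exact: Ck_onW|exact: Dg].
move=> x Ux; rewrite [RHS]deriveE; last exact: dgf.
rewrite (diff_comp (df _ Ux) (dg _ (fU _ Ux))) /= -(deriveE _ (df _ Ux)).
rewrite [in RHS](el ('D_v f x)) linear_sum fct_sumE.
apply: eq_bigr => i _; rewrite linearZ /= -deriveE //; exact/dg/fU.
Qed.

End Chain.

Section ChainInst.
Variables (R : realType) (V : normedModType R).

Lemma Ck_on_comp1 k (U : set V) (U' : set R) (f : V -> R) (g : R -> R) :
  open U -> (forall x, U x -> U' (f x)) ->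
  Ck_on k U f -> Ck_on k U' g -> Ck_on k U (g \o f).
Proof.
move=> oU fU.
apply: (@Ck_on_comp_coord R V R 1 (fun=> 1) (fun=> idfun) _ _ k U U' f g oU fU).
- by move=> _ x; exact: cvg_id.
- by move=> w; rewrite big_ord1 /GRing.scale /= mulr1.
Qed.

Lemma continuous_coord m (i : 'I_m) : continuous (fun x : 'rV[R]_m => x 0 i).
Proof. by move=> x; exact: coord_continuous. Qed.

Definition coordf m (i : 'I_m) (x : 'rV[R]_m) : R := x 0 i.

Lemma coordf_is_linear m (i : 'I_m) : linear (coordf i : 'rV[R]_m -> R).
Proof. by move=> a u v; rewrite /coordf !mxE. Qed.

HB.instance Definition _ m (i : 'I_m) :=
  GRing.isLinear.Build R 'rV[R]_m R _ (@coordf m i) (coordf_is_linear i).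

Lemma Ck_on_comp m k (U : set V) (U' : set 'rV[R]_m) (f : V -> 'rV[R]_m)
    (g : 'rV[R]_m -> R) :
  open U -> (forall x, U x -> U' (f x)) ->
  Ck_on k U f -> Ck_on k U' g -> Ck_on k U (g \o f).
Proof.
move=> oU fU.
apply: (@Ck_on_comp_coord R V 'rV[R]_m m (fun i => delta_mx 0 i)
  (fun i => coordf i) _ _ k U U' f g oU fU).
- move=> i; exact: continuous_coord.
- by move=> w; rewrite [LHS]row_sum_delta.
Qed.

End ChainInst.

(** * Means over the unit interval and Hadamard's lemma *)
Section Mean.
Variable R : realType.
Implicit Types f g : R -> R.

Definition mean f : R := \int[@lebesgue_measure R]_(t in `[0, 1]) f t.

Let integrable_unit f : continuous f ->
  (@lebesgue_measure R).-integrable `[0, 1] (EFin \o f).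
Proof.
move=> cf; apply: continuous_compact_integrable; first exact: segment_compact.
exact: continuous_subspaceT.
Qed.

Lemma meanD f g : continuous f -> continuous g ->
  mean (fun t => f t + g t) = mean f + mean g.
Proof. by move=> cf cg; apply: RintegralD => //; exact: integrable_unit. Qed.

Lemma meanB f g : continuous f -> continuous g ->
  mean (fun t => f t - g t) = mean f - mean g.
Proof. by move=> cf cg; apply: RintegralB => //; exact: integrable_unit. Qed.

Lemma meanZ f a : continuous f -> mean (fun t => a * f t) = a * mean f.
Proof. by move=> cf; apply: RintegralZl => //; exact: integrable_unit. Qed.

Lemma mean_cst a : mean (fun=> a) = a.
Proof.
rewrite /mean Rintegral_cst //= lebesgue_measure_itv /= lte_fin ltr01.
by rewrite oppr0 adde0 mulr1.
Qed.

Lemma continuous_sum_fun n (f : 'I_n -> R -> R) :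
  (forall i, continuous (f i)) -> continuous (fun t => \sum_i f i t).
Proof.
move=> cf; apply: continuous_big => [|i _]; last exact: cf.
by move=> x; apply: (@cvgD _ R^o); [exact: cvg_fst|exact: cvg_snd].
Qed.

Lemma mean_sum n (f : 'I_n -> R -> R) : (forall i, continuous (f i)) ->
  mean (fun t => \sum_i f i t) = \sum_i mean (f i).
Proof.
elim: n f => [|n IH] f cf.
  rewrite big_ord0 -[RHS](mean_cst 0); congr mean.
  by apply/funext => t; rewrite big_ord0.
rewrite big_ord_recl -IH -?meanD //.
- by congr mean; apply/funext => t; rewrite big_ord_recl.
- by apply: continuous_sum_fun => i; exact: cf.
Qed.

Lemma norm_mean_le f e : continuous f ->
  (forall t, t \in `[0, 1]%R -> `|f t| <= e) -> `|mean f| <= e.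
Proof.
move=> cf fe; apply: le_trans (le_normr_Rintegral _ _) _ => //.
  exact: integrable_unit.
rewrite -[leRHS]mean_cst; apply: le_Rintegral => //.
- apply: (@integrable_unit (fun t => `|f t|)) => t.
  by apply: cvg_norm; exact: cf.
- by apply: integrable_unit => t; exact: cvg_cst.
Qed.

Lemma mean_derive f g : continuous f ->
  (forall t : R, is_derive t (1 : R) g (f t)) ->
  mean f = g 1 - g 0.
Proof.
move=> cf gf; rewrite /mean /Rintegral.
have cg : continuous g.
  by move=> t; apply/differentiable_continuous/derivable1_diffP.
rewrite (@continuous_FTC2 _ f g) //=.
- exact: continuous_subspaceT.
- split; first by move=> t _.
  + by apply: cvg_at_right_filter; exact: cg.
  + by apply: cvg_at_left_filter; exact: cg.
- by move=> t _; rewrite derive1E derive_val.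
Qed.

End Mean.

Section SegmentMean.
Variables (R : realType) (m : nat) (b : 'rV[R]_m).
Local Notation V := 'rV[R]_m.
Implicit Types F : V -> R.

Definition seg (t : R) (x : V) : V := b + t *: (x - b).

(** The weights t ^+ j make this family stable under differentiation in x: each
    derivative brings out one more factor t. *)
Definition segmean j F (x : V) : R := mean (fun t => t ^+ j * F (seg t x)).

Lemma seg_continuous2 : continuous (fun z : R * V => seg z.1 z.2).
Proof.
move=> z; apply: cvgD; first exact: cvg_cst.
apply: (@cvgZ _ V); first exact: cvg_fst.
by apply: cvgB; [exact: cvg_snd|exact: cvg_cst].
Qed.

Lemma seg_continuous x : continuous (seg ^~ x).
Proof.
move=> t; apply: cvgD; first exact: cvg_cst.
by apply: (@cvgZ _ V); [exact: cvg_id|exact: cvg_cst].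
Qed.

Lemma continuous_seg_integrand j F x : continuous F ->
  continuous (fun t : R => t ^+ j * F (seg t x)).
Proof.
move=> cF t; apply: cvgM; first exact: exprn_continuous.
by apply: continuous_comp; [exact: seg_continuous|exact: cF].
Qed.

(** Compactness of the unit interval: nearby segments from b are uniformly close. *)
Lemma seg_unif_continuous F (x : V) (e : R) : continuous F -> 0 < e ->
  \forall y \near x, forall t, t \in `[0, 1]%R ->
    `|F (seg t y) - F (seg t x)| < e.
Proof.
move=> cF e0.
have /compact_near_coveringP/near_covering_withinP K :=
  @segment_compact R 0 1.
have := K V (nbhs x) (fun y t => `|F (seg t y) - F (seg t x)| < e) _ _.
move=> H; near=> y => t t01; move: t t01.
suff : `[0, 1] `<=` (fun t => `|F (seg t y) - F (seg t x)| < e).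
  by move=> S t t01; apply: S.
near: y; apply: H => /= t0 _.
have c1 : F (seg z.1 z.2) @[z --> (t0, x)] --> F (seg t0 x).
  apply: continuous_comp; first exact: (@seg_continuous2 (t0, x)).
  exact: cF.
have c2 : F (seg z.1 x) @[z --> (t0, x)] --> F (seg t0 x).
  apply: (@continuous_comp _ _ _ fst (fun t => F (seg t x)) (t0, x)).
    exact: cvg_fst.
  by apply: continuous_comp; [exact: seg_continuous|exact: cF].
have c0 : F (seg z.1 z.2) - F (seg z.1 x) @[z --> (t0, x)] --> (0 : R).
  by rewrite -(subrr (F (seg t0 x))); exact: cvgB c1 c2.
have := cvgr0_norm_lt _ c0 _ e0.
case=> -[P Q] /= [Pt Qx] PQ; exists (P, Q) => //= -[t y] /= ty _.
exact: (PQ (t, y)).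
Unshelve. all: by end_near. Qed.

Lemma expr_unit_norm_le1 (t : R) j : t \in `[0, 1]%R -> `|t ^+ j| <= 1.
Proof.
rewrite in_itv /= => /andP[t0 t1].
by rewrite ger0_norm ?exprn_ge0 // exprn_ile1.
Qed.

Lemma segmean_continuous j F : continuous F -> continuous (segmean j F).
Proof.
move=> cF x.
apply/(@cvgrPdist_le _ _ _ (nbhs x) (@nbhs_filter _ x)) => e e0.
have := @seg_unif_continuous F x e cF e0; apply: filterS => y yx.
rewrite distrC /segmean -meanB; try exact: continuous_seg_integrand.
apply: norm_mean_le => [t|t t01].
  by apply: cvgB; exact: continuous_seg_integrand.
rewrite -mulrBr normrM ltW //.
rewrite (le_lt_trans (ler_piMl _ (expr_unit_norm_le1 j t01))) //.
exact: yx.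
Qed.

End SegmentMean.

(** Frechet differentiability from an epsilon estimate, with the candidate
    differential given beforehand. *)
Lemma differentiable_estimate (R : realType) (V W : normedModType R)
    (f : V -> W) (L : {linear V -> W}) (x : V) : continuous L ->
  (forall e, 0 < e ->
    \forall y \near x, `|f y - f x - L (y - x)| <= e * `|y - x|) ->
  differentiable f x /\ 'd f x = L :> (V -> W).
Proof.
move=> cL fL.
have fE : f \o shift x = cst (f x) + L +o_ 0 id.
  apply/eqaddoP => e e0; have := fL e e0.
  rewrite (near_shift 0 x); apply: filterS => h /=.
  by rewrite subr0 addrK /= opprD addrA.
have dE := diff_unique cL fE.
split=> //; apply/diff_locallyP.
by rewrite dE; split.
Qed.

Lemma coord_norm_le (R : realType) m (x : 'rV[R]_m) i : `|x 0 i| <= `|x|.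
Proof.
rewrite [leRHS]mx_normrE.
exact: (le_bigmax _ (fun i : 'I_1 * 'I_m => `|x i.1 i.2|) (0, i)).
Qed.

Lemma is_derive_line (R : realType) (V : normedModType R) (F : V -> R)
    (p w : V) (s : R) : differentiable F (p + s *: w) ->
  is_derive s (1 : R) (fun s => F (p + s *: w)) ('D_w F (p + s *: w)).
Proof.
move=> dF.
have E : (fun h : R => h^-1 *:
      (((fun s => F (p + s *: w)) \o shift s) (h *: (1 : R)) - F (p + s *: w)))
   = (fun h : R => h^-1 *: ((F \o shift (p + s *: w)) (h *: w) - F (p + s *: w))).
  apply/funext => h /=; congr (_ *: (F _ - _)).
  by rewrite [h *: (1 : R)]mulr1 scalerDl addrCA addrA.
apply: DeriveDef; last by rewrite /derive E.
have := @diff_derivable _ _ _ F _ w dF; by rewrite /derivable E.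
Qed.

Section Partial.
Variables (R : realType) (m : nat).
Local Notation V := 'rV[R]_m.
Implicit Types F : V -> R.

Definition partial (i : 'I_m) F : V -> R := 'D_(delta_mx 0 i) F.

Lemma derive_partial F (x v : V) : differentiable F x ->
  'D_v F x = \sum_i v 0 i * partial i F x.
Proof.
move=> dF; rewrite deriveE // [in LHS](row_sum_delta v) linear_sum.
by apply: eq_bigr => i _; rewrite linearZ /= /partial deriveE.
Qed.

Section SegmeanDiff.
Variables (b : V) (j : nat) (F : V -> R).
Hypothesis dF : forall x, differentiable F x.
Hypothesis cdF : forall v, continuous ('D_v F).

Definition segmean_diff (x v : V) : R := segmean b j.+1 ('D_v F) x.

Lemma segmean_diffE x v :
  segmean_diff x v = \sum_i v 0 i * segmean_diff x (delta_mx 0 i).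
Proof.
rewrite /segmean_diff /segmean.
rewrite (_ : (fun t => _) = (fun t => \sum_i v 0 i *
    (t ^+ j.+1 * partial i F (seg b t x)))); last first.
  apply/funext => t; rewrite derive_partial // mulr_sumr.
  by apply: eq_bigr => i _; rewrite mulrCA.
rewrite mean_sum; last first.
  move=> i t; apply: cvgM; first exact: cvg_cst.
  exact: (@continuous_seg_integrand _ _ b j.+1 (partial i F) x (@cdF _) t).
apply: eq_bigr => i _; rewrite meanZ //.
exact: (@continuous_seg_integrand _ _ b j.+1 (partial i F) x (@cdF _)).
Qed.

Lemma segmean_diff_is_linear x : linear (segmean_diff x : V -> R).
Proof.
move=> a u v; rewrite (segmean_diffE x (a *: u + v)).
rewrite (segmean_diffE x u) (segmean_diffE x v).
rewrite [X in _ = X + _]mulr_sumr -big_split; apply: eq_bigr => i _ /=.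
by rewrite !mxE mulrDl mulrA.
Qed.

Lemma segmean_diff_continuous x : continuous (segmean_diff x).
Proof.
rewrite (_ : segmean_diff x =
  fun v => \sum_i v 0 i * segmean_diff x (delta_mx 0 i)); last first.
  by apply/funext => v; exact: segmean_diffE.
apply: continuous_big => [z|i _].
  by apply: (@cvgD _ R^o); [exact: cvg_fst|exact: cvg_snd].
move=> v; apply: (@continuousM _ V (fun v : V => v 0 i) (cst _)).
  exact: (@continuous_coord _ _ i v).
exact: cst_continuous.
Qed.

Lemma seg_line t x v s : seg b t (x + s *: v) = seg b t x + s *: (t *: v).
Proof.
by rewrite /seg [x + _ - b]addrAC scalerDr addrA !scalerA mulrC.
Qed.

(** The mean value theorem along the segment from x to y bounds the integrand of
    the remainder by the oscillation of the partial derivatives, uniformly in t. *)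
Lemma segmean_estimate x e : 0 < e -> \forall y \near x,
  `|segmean b j F y - segmean b j F x - segmean_diff x (y - x)| <= e * `|y - x|.
Proof.
move=> e0; (* m partial derivatives contribute, each with oscillation below e'; the
   successor keeps the divisor nonzero when m = 0. *)
pose e' := e / m.+1%:R.
have e'0 : 0 < e' by rewrite divr_gt0.
have cF : continuous F by move=> z; exact: differentiable_continuous.
have : \forall y \near x, forall i : 'I_m, forall t, t \in `[0, 1]%R ->
    `|partial i F (seg b t y) - partial i F (seg b t x)| < e'.
  apply: (@filter_forall _ _ _ (nbhs x) (@nbhs_filter _ x)) => i.
  exact: (@seg_unif_continuous _ _ b _ x e' (@cdF _) e'0).
move=> /nbhs_ballP[d /= d0 Hd]; apply/nbhs_ballP; exists d => //= y.
set v := y - x => xy.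
have xE : y = x + 1 *: v by rewrite scale1r addrCA subrr addr0.
have c1 z : continuous (fun t : R => t ^+ j * F (seg b t z)).
  exact: continuous_seg_integrand.
have c2 : continuous (fun t : R => t ^+ j * F (seg b t y) - t ^+ j * F (seg b t x)).
  by move=> t; apply: cvgB; exact: c1.
have c3 : continuous (fun t : R => t ^+ j.+1 * 'D_v F (seg b t x)).
  exact: (continuous_seg_integrand (@cdF v)).
rewrite /segmean_diff /segmean -(meanB (c1 y) (c1 x)) -(meanB c2 c3).
apply: norm_mean_le => [t|t t01]; first by apply: cvgB; [exact: c2|exact: c3].
rewrite exprSr -mulrBr -mulrA -mulrBr normrM.
apply: le_trans (ler_piMl _ (expr_unit_norm_le1 j t01)) _ => //.
have [c c01 hc] : exists2 c, c \in `]0, 1[%R &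
    F (seg b t y) - F (seg b t x) = t * 'D_v F (seg b t (x + c *: v)).
  have h' s : is_derive s (1 : R) (fun s => F (seg b t x + s *: (t *: v)))
      ('D_(t *: v) F (seg b t x + s *: (t *: v))) by exact: is_derive_line.
  have ch : {within `[0, 1], continuous (fun s => F (seg b t x + s *: (t *: v)))}.
    apply: continuous_subspaceT => s.
    exact/differentiable_continuous/derivable1_diffP.
  have [c c01] := MVT ltr01 (fun s _ => h' s) ch.
  rewrite -!seg_line -xE scale0r addr0 subr0 mulr1 => E; exists c => //.
  by rewrite E !deriveE // linearZ.
rewrite hc -mulrBr normrM.
have t1 : `|t| <= 1 by exact: (expr_unit_norm_le1 1 t01).
apply: le_trans (ler_piMl _ t1) _ => //.
rewrite !derive_partial // -sumrB.
apply: le_trans (ler_norm_sum _ _ _) _.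
apply: (@le_trans _ _ (\sum_(i < m) `|v| * e')).
  apply: ler_sum => i _; rewrite -mulrBr normrM; apply: ler_pM => //.
    exact: coord_norm_le.
  apply/ltW/Hd => //.
  move: xy; rewrite -!ball_normE /= opprD addNKr normrN normrZ.
  rewrite distrC -/v; apply: le_lt_trans; rewrite ler_piMl //.
  by move: c01; rewrite in_itv /= => /andP[c_gt0 c_lt1]; rewrite ger0_norm ltW.
rewrite sumr_const card_ord -mulr_natr -mulrA mulrC ler_wpM2r //.
rewrite /e' -mulrA ler_piMr ?(ltW e0) //.
by rewrite mulrC ler_pdivrMr // mul1r ler_nat.
Qed.

Lemma segmean_differentiable x : differentiable (segmean b j F) x /\
  forall v, 'D_v (segmean b j F) x = segmean b j.+1 ('D_v F) x.
Proof.
pose Lx := GRing.isLinear.Build R V R _ (segmean_diff x) (segmean_diff_is_linear x).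
pose L : {linear V -> R} := HB.pack (segmean_diff x) Lx.
have [d dE] := @differentiable_estimate _ _ _ (segmean b j F) L x
  (@segmean_diff_continuous x) (@segmean_estimate x).
by split=> // v; rewrite deriveE // dE.
Qed.

End SegmeanDiff.

(** One degree of regularity is lost because differentiating under the mean uses
    continuity of the derivative of F; smooth functions do not feel it. *)
Lemma Ck_on_segmean b k j F : Ck_on k.+1 setT F ->
  Ck_on k setT (segmean b j F).
Proof.
elim: k j F => [|k IH] j F.
  move=> [dF _] x _; apply: segmean_continuous => z.
  exact/differentiable_continuous/dF.
move=> [dF DF].
have {}DF v : Ck_on k.+1 setT ('D_v F) by exact: DF.
have H := segmean_differentiable b j (fun x => dF x Logic.I)
  (fun v x => Ck_on_continuous (DF v) Logic.I).
split=> [x _|v]; first by have [] := H x.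
rewrite (_ : 'D_v _ = segmean b j.+1 ('D_v F)); first exact: IH.
by apply/funext => x; have [_ ->] := H x.
Qed.

(** F x - F b is the mean over t of the derivative of t |-> F (b + t (x - b)),
    and that derivative is linear in x - b. *)
Lemma hadamard (F : V -> R) (b : V) : smooth_on setT F ->
  exists H : 'I_m -> V -> R, [/\ forall i, smooth_on setT (H i),
    forall x, F x = F b + \sum_i (x - b) 0 i * H i x &
    forall i, H i b = partial i F b].
Proof.
move=> sF; have [dF DF] := sF 1%N.
have cD v : continuous ('D_v F) by move=> x; exact: DF.
exists (fun i => segmean b 0 (partial i F)); split.
- by move=> i k; apply: Ck_on_segmean; have [_] := sF k.+2; apply.
- move=> x; pose w := x - b.
  have h s : is_derive s (1 : R) (fun s => F (b + s *: w)) ('D_w F (b + s *: w)).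
    by apply: is_derive_line; exact: dF.
  have cDw : continuous (fun s : R => 'D_w F (b + s *: w)).
    rewrite (_ : (fun s => _) = fun s : R => s ^+ 0 * 'D_w F (seg b s x)).
      exact: (continuous_seg_integrand (cD w)).
    by apply/funext => s; rewrite expr0 mul1r.
  have := mean_derive cDw h; rewrite scale1r scale0r addr0 subrKC => E.
  rewrite -[LHS](subrKC (F b)) -E; congr (_ + _).
  rewrite (_ : (fun s => _) = fun s => \sum_i w 0 i *
      (s ^+ 0 * partial i F (seg b s x))); last first.
    apply/funext => s; rewrite derive_partial; last exact: dF.
    by apply: eq_bigr => i _; rewrite expr0 mul1r.
  have cseg i : continuous (fun s : R => s ^+ 0 * partial i F (seg b s x)).
    exact: (continuous_seg_integrand (cD _)).
  rewrite mean_sum => [|i].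
    by apply: eq_bigr => i _; rewrite meanZ.
  by move=> s; apply: cvgM; [exact: cvg_cst|exact: cseg].
- move=> i; rewrite /segmean -[RHS]mean_cst; congr mean; apply/funext => t.
  by rewrite expr0 mul1r /seg subrr scaler0 addr0.
Qed.

End Partial.

(** * Bump functions *)
Section Flat.
Variable R : realType.

(** The classical flat function exp (- 1 / t), multiplied by powers of 1 / t so
    that the family is stable under differentiation. *)
Definition flat (n : nat) (t : R) : R :=
  if 0 < t then t^-1 ^+ n * expR (- t^-1) else 0.

Lemma flat_ge0 n t : 0 <= flat n t.
Proof.
rewrite /flat; case: ifPn => // t0.
by rewrite mulr_ge0 ?expR_ge0 // exprn_ge0 // invr_ge0 ltW.
Qed.

Lemma flat_gt0 n t : (0 < flat n t) = (0 < t).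
Proof.
rewrite /flat; case: ifPn => t0; last by rewrite ltxx.
by rewrite mulr_gt0 ?expR_gt0 // exprn_gt0 // invr_gt0.
Qed.

Lemma flatS n t : flat n t = t * flat n.+1 t.
Proof.
rewrite /flat; case: ifPn => t0; last by rewrite mulr0.
by rewrite exprS !mulrA divff ?mul1r // gt_eqF.
Qed.

(** The exponential series at 1 / t dominates its term of degree n + 1; this is
    what makes every member of the family continuous at 0. *)
Lemma flat_le n t : `|flat n t| <= n.+1`!%:R * `|t|.
Proof.
rewrite ger0_norm ?flat_ge0 // /flat; case: ifPn => t0; last exact: mulr_ge0.
rewrite (gtr0_norm t0) expRN.
have u0 : 0 < t^-1 by rewrite invr_gt0.
have := expR_ge1Dxn n (ltW u0).
move: (expR_gt0 t^-1); set E := expR _ => E0 H.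
rewrite ler_pdivrMr //.
have f0 : 0 < n.+1`!%:R :> R by rewrite ltr0n fact_gt0.
have {}H : t^-1 ^+ n.+1 <= n.+1`!%:R * E.
  by rewrite mulrC -ler_pdivrMr //; apply: le_trans H; rewrite lerDr.
rewrite -mulrA [t * E]mulrC mulrA -ler_pdivrMr //.
by rewrite -exprSr.
Qed.

Lemma flat_continuous0 n : {for 0, continuous (flat n)}.
Proof.
have f0 : flat n 0 = 0 by rewrite /flat ltxx.
apply/cvgrPdist_le => e e0; rewrite /= f0.
have f1 : 0 < n.+1`!%:R :> R by rewrite ltr0n fact_gt0.
near=> t.
rewrite distrC subr0; apply: le_trans (flat_le _ _) _.
rewrite mulrC -ler_pdivlMr //; near: t.
have e1 : 0 < e / n.+1`!%:R by rewrite divr_gt0.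
apply/nbhs_ballP; exists (e / n.+1`!%:R) => //= t /=.
by rewrite sub0r normrN => /ltW.
Unshelve. all: by end_near. Qed.

Lemma is_derive_flat n (t : R) :
  is_derive t (1 : R) (flat n) (flat n.+2 t - n%:R * flat n.+1 t).
Proof.
have [t0|t0|t0] := ltgtP t 0.
- have E : {near t, cst 0 =1 flat n}.
    near=> s; rewrite /flat; have s0 : s < 0 by near: s; exact: lt_nbhsl.
    by rewrite ltNge ltW.
  apply: near_eq_is_derive E _ => //.
  rewrite /flat !(ltNge 0 t) (ltW t0) /= mulr0 subr0; exact: is_derive_cst.
- have E : {near t, (fun u => u ^+ n * expR (- u)) \o (fun s : R => s^-1) =1 flat n}.
    near=> s; rewrite /flat /=; have -> // : 0 < s by near: s; exact: lt_nbhsr.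
  apply: near_eq_is_derive E _ => //.
  have d1 : is_derive t (1 : R) (fun s : R => s^-1) (- t^-1 ^+ 2).
    have := @is_deriveV R id t 1 1; rewrite /= gt_eqF // => /(_ isT).
    by rewrite exprVn [_ *: _]mulr1; apply; exact: is_derive_id.
  have d2 : is_derive t^-1 (1 : R) (fun u : R => expR (- u)) (- expR (- t^-1)).
    rewrite -[X in is_derive _ _ _ X]mulrN1.
    exact: (@is_derive1_comp _ expR -%R).
  have d3 : is_derive t^-1 (1 : R) (fun u : R => u ^+ n * expR (- u))
      (t^-1 ^+ n * - expR (- t^-1) + expR (- t^-1) * (n%:R * t^-1 ^+ n.-1)).
    have dX : is_derive t^-1 (1 : R) (fun u : R => u ^+ n) (n%:R * t^-1 ^+ n.-1).
      have := @is_deriveX _ _ (id : R -> R) n t^-1 1 1 (is_derive_id _ _).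
      by rewrite [_ *: _]mulr1 fctE.
    exact: (is_deriveM dX d2).
  have := @is_derive1_comp _ _ _ t _ _ d3 d1.
  congr (is_derive _ _ _ _); rewrite /flat t0 !exprS.
  case: n {d2 d3} => [|n] /=; first by rewrite !expr0; ring.
  by rewrite exprS; ring.
- (* The difference quotient at 0 is the next function of the family. *)
  rewrite t0; have f0 k : flat k 0 = 0 by rewrite /flat ltxx.
  rewrite !f0 mulr0 subr0.
  have H : h^-1 *: ((flat n \o shift 0) (h *: (1 : R)) - flat n 0)
      @[h --> 0^'] --> (0 : R).
    have := @flat_continuous0 n.+1.
    rewrite /prop_for /continuous_at f0 => /cvg_within_filter H.
    apply: cvg_trans (H _); apply: near_eq_cvg.
    near=> h.
    have h0 : h != 0 by near: h; exact: nbhs_dnbhs_neq.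
    rewrite /= addr0 [h *: (1 : R)]mulr1 f0 subr0 [flat n h]flatS /GRing.scale /=.
    by rewrite mulrA mulVf ?mul1r.
  apply: DeriveDef; first by apply/cvg_ex; exists 0.
  by apply: cvg_lim.
Unshelve. all: by end_near. Qed.

Lemma smooth_flat n : smooth_on setT (flat n).
Proof.
move=> k; elim: k n => [|k IH] n.
  move=> t _; apply/differentiable_continuous/derivable1_diffP.
  by have [] := is_derive_flat n t.
have df t : differentiable (flat n) t.
  by apply/derivable1_diffP; have [] := is_derive_flat n t.
split=> // v.
rewrite (_ : 'D_v _ = v *: (flat n.+2 + (- n%:R) *: flat n.+1)).
  by apply: Ck_onZ openT _; apply: Ck_onD openT _ _ => //; exact: Ck_onZ openT _.
apply/funext => t; rewrite deriveE // -[v in LHS]mulr1 linearZ /= -deriveE //.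
by rewrite (@derive_val _ _ _ _ _ _ _ (is_derive_flat n t)) scaleNr.
Qed.

End Flat.

Section Bump.
Variables (R : realType) (m : nat).
Local Notation V := 'rV[R]_m.

Lemma smooth_cst (V W : normedModType R) (U : set V) (a : W) :
  smooth_on U (cst a).
Proof. by move=> k; exact: Ck_on_cst. Qed.

Lemma smooth_coord (U : set V) i : open U -> smooth_on U (fun x : V => x 0 i).
Proof.
move=> oU k; case: k => [|k].
  by move=> x _; exact: continuous_coord.
split=> [x _|v]; first exact: differentiable_coord.
apply: (@Ck_on_eq _ _ _ _ _ (cst (v 0 i))) => //; last exact: Ck_on_cst.
move=> x Ux; rewrite deriveE; last exact: differentiable_coord.
have cl : continuous (@coordf R m i) by exact: continuous_coord.
by rewrite -[LHS]/(coordf i v) -(diff_lin x cl).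
Qed.

Definition bump (a : V) (r : R) (x : V) : R :=
  flat 0 (r - \sum_i (x 0 i - a 0 i) ^+ 2).

Lemma smooth_bump a r : smooth_on setT (bump a r).
Proof.
move=> k; have oT := @openT V.
apply: (@Ck_on_comp1 _ _ _ _ setT (fun x : V => r - \sum_i (x 0 i - a 0 i) ^+ 2)) => //;
  last exact: smooth_flat.
rewrite (_ : (fun x : V => _) =
  cst r - \sum_i (fun x : V => (x 0 i - a 0 i) ^+ 2)); last first.
  by apply/funext => x; rewrite !fctE fct_sumE.
apply: Ck_onB => //; first exact: Ck_on_cst.
apply: Ck_on_sum => // i.
have c : Ck_on k setT (fun x : V => x 0 i - a 0 i).
  by apply: (Ck_onB oT (smooth_coord i oT k) (@Ck_on_cst _ _ _ _ _ (a 0 i))).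
exact: (Ck_onM oT c c).
Qed.

(** The norm of row vectors is the sup norm, so a closed cube inside U serves as
    the compact set, and the Euclidean ball carrying [bump] lies in the cube. *)
Lemma bump_exists (U : set V) (a : V) : open U -> U a ->
  exists (f : V -> R) (K : set V), [/\ smooth_on setT f, f a != 0,
    compact K, K `<=` U & forall x, ~ K x -> f x = 0].
Proof.
move=> oU Ua.
have /nbhs_ballP[e /= e0 eU] : nbhs a U by exact: open_nbhs_nbhs.
pose r := e / 2; have r0 : 0 < r by rewrite divr_gt0.
exists (bump a (r ^+ 2)).
exists [set v | forall i, [set` `[a 0 i - r, a 0 i + r]] (v 0 i)]; split.
- exact: smooth_bump.
- rewrite gt_eqF // flat_gt0 big1 ?subr0 ?exprn_gt0 // => i _.
  by rewrite subrr expr0n.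
- apply: (@rV_compact R m (fun i => [set` `[a 0 i - r, a 0 i + r]])) => i.
  exact: segment_compact.
- move=> x Kx; apply: eU; split=> // i j; rewrite ord1 -ball_normE /= distrC.
  have := Kx j; rewrite /= in_itv /= -ler_distl => /le_lt_trans; apply.
  by rewrite /r ltr_pdivrMr // mulr_natr mulr2n ltrDl.
- move=> x /existsNP[i /=]; rewrite in_itv /= -ler_distl => /negP; rewrite -ltNge => xi.
  apply/eqP; rewrite eq_le flat_ge0 andbT leNgt flat_gt0 -leNgt subr_le0.
  rewrite (bigD1 i) //= -[leLHS]addr0 lerD //; last first.
    by apply: sumr_ge0 => j _; exact: sqr_ge0.
  by rewrite -[leRHS]real_normK ?num_real // lerXn2r ?nnegrE ?(ltW r0) // ltW.
Qed.

End Bump.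

(** * Partial derivatives and cut-offs *)
Section PartialRules.
Variables (R : realType) (m : nat).
Local Notation V := 'rV[R]_m.

Lemma partialM i (f g : V -> R) x :
  differentiable f x -> differentiable g x ->
  partial i (f * g) x = f x * partial i g x + g x * partial i f x.
Proof. by move=> df dg; rewrite /partial deriveM //; exact: diff_derivable. Qed.

Lemma partial_coord (i j : 'I_m) (a x : V) :
  partial i (fun x : V => x 0 j - a 0 j) x = (i == j)%:R.
Proof.
rewrite /partial (_ : (fun x : V => _) = (fun x : V => x 0 j) - cst (a 0 j)) //.
rewrite deriveB; [|exact/diff_derivable/differentiable_coord|exact: derivable_cst].
rewrite derive_cst subr0 deriveE; last exact: differentiable_coord.
have cl : continuous (@coordf R m j) by exact: continuous_coord.
rewrite (_ : (fun x : V => x 0 j) = coordf j) //.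
by rewrite (diff_lin x cl) -[LHS]/((delta_mx 0 i : V) 0 j) mxE eqxx eq_sym.
Qed.

Lemma partial_near i (f g : V -> R) (U : set V) x : open U -> U x ->
  (forall y, U y -> f y = g y) -> partial i f x = partial i g x.
Proof.
move=> oU Ux fg; apply: near_eq_derive.
by have := open_nbhs_nbhs (conj oU Ux); apply: filterS => y /fg.
Qed.

End PartialRules.

Lemma open_compact_setC (T : topologicalType) (K : set T) :
  hausdorff_space T -> compact K -> open (~` K).
Proof. by move=> hT cK; rewrite openC; exact: compact_closed. Qed.

(** Only the values of h on U matter: off K the product vanishes identically, even
    where h is junk. *)
Lemma smooth_cutoff (R : realType) m (U K : set 'rV[R]_m)
    (f h : 'rV[R]_m -> R) : open U -> compact K -> K `<=` U ->
  smooth_on setT f -> (forall x, ~ K x -> f x = 0) -> smooth_on U h ->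
  smooth_on setT (f * h).
Proof.
move=> oU cK KU sf f0 sh k; apply: Ck_on_local => x _.
have [Ux|nUx] := pselect (U x).
  exists U; split=> //.
  by apply: Ck_onM (oU) (Ck_on_sub _ (sf k)) (sh k) => ?.
exists (~` K); split; first by move/KU.
apply: (@Ck_on_eq _ _ _ _ _ (cst 0)); last exact: Ck_on_cst.
  exact: open_compact_setC (@norm_hausdorff _ _) cK.
move=> y Ky; have -> : (f * h) y = f y * h y by [].
by rewrite (f0 y Ky) mul0r.
Qed.

(** * Extending functions from a chart to the manifold *)
Section Chart.
Variables (R : realType) (m : nat) (M : topologicalType) (c : chart R m M).

Lemma chart_invK x : (chart_map c @` chart_dom c) x ->
  chart_dom c (chart_inv c x) /\ chart_map c (chart_inv c x) = x.
Proof. by move=> [p cp <-]; rewrite chart_mapK. Qed.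

Lemma chart_image_open (O : set M) : open O ->
  open (chart_map c @` (chart_dom c `&` O)).
Proof.
move=> oO; have oc := chart_cod_open c.
have cI := @chart_inv_continuous _ _ _ c; rewrite continuous_open_subspace // in cI.
rewrite openE => _ [p [cp Op] <-].
have cpx : (chart_map c @` chart_dom c) (chart_map c p) by exists p.
have cIp : chart_inv c x @[x --> chart_map c p] --> p.
  by rewrite -{2}(chart_mapK cp); apply: cI; rewrite inE.
have Op' : nbhs p O by exact: open_nbhs_nbhs.
have := cIp _ Op'; rewrite nbhs_simpl /= /interior.
have := open_nbhs_nbhs (conj oc cpx).
apply: filterS2 => x xc Ox.
by have [xd xE] := chart_invK xc; exists (chart_inv c x).
Qed.

Definition extend (k : 'rV[R]_m -> R) (q : M) : R :=
  if `[< chart_dom c q >] then k (chart_map c q) else 0.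

Lemma extend_in k q : chart_dom c q -> extend k q = k (chart_map c q).
Proof. by move=> cq; rewrite /extend asboolT. Qed.

Lemma extend_out k q : ~ chart_dom c q -> extend k q = 0.
Proof. by move=> cq; rewrite /extend asboolF. Qed.

Lemma extend_inv k x : (chart_map c @` chart_dom c) x ->
  extend k (chart_inv c x) = k x.
Proof. by move=> /chart_invK[cx xE]; rewrite extend_in // xE. Qed.

End Chart.

Section Extend.
Variables (R : realType) (m : nat) (M : smoothManifold R m).
Variables (c : chart R m M) (ac : mfd_atlas c).
Local Notation cod := (chart_map c @` chart_dom c).

(** Hausdorffness enters here: the preimage of K is compact, hence closed, so the
    extension vanishes near every point outside the chart domain. *)
Lemma smooth_extend (K : set 'rV[R]_m) (k : 'rV[R]_m -> R) :
  compact K -> K `<=` cod -> (forall x, ~ K x -> k x = 0) ->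
  smooth_on cod k -> smooth_function (extend c k).
Proof.
move=> cK Kc k0 sk d ad n; apply: Ck_on_local => _ [q dq <-].
have oc := chart_dom_open c; have od := chart_dom_open d.
have [cq|ncq] := pselect (chart_dom c q).
  exists (chart_map d @` (chart_dom d `&` chart_dom c)); split; first by exists q.
  apply: (@Ck_on_eq _ _ _ _ _ (k \o (chart_map c \o chart_inv d))).
  - exact: chart_image_open.
  - by move=> _ [r [dr cr] <-]; rewrite /= chart_mapK // extend_in.
  apply: (@Ck_on_comp _ _ _ _ _ cod);
    [exact: chart_image_open| |exact: mfd_compat|exact: sk].
  by move=> _ [r [dr cr] <-] /=; rewrite chart_mapK //; exists r.
have oN : open (~` (chart_inv c @` K)).
  apply: open_compact_setC; first exact: mfd_hausdorff.
  apply: continuous_compact => //.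
  exact: continuous_subspaceW Kc (@chart_inv_continuous _ _ _ c).
exists (chart_map d @` (chart_dom d `&` ~` (chart_inv c @` K))); split.
  exists q => //; split=> // -[x Kx xq]; apply: ncq; rewrite -xq.
  by have [] := chart_invK (Kc _ Kx).
apply: (@Ck_on_eq _ _ _ _ _ (cst 0)); last exact: Ck_on_cst.
  exact: chart_image_open.
move=> _ [r [dr Nr] <-]; rewrite /= chart_mapK //.
have [cr|?] := pselect (chart_dom c r); last by rewrite extend_out.
rewrite extend_in // k0 // => Kr; apply: Nr; exists (chart_map c r) => //.
exact: chart_mapK.
Qed.

Lemma smooth_chart_fun (f : smoothfun M) : smooth_on cod (f \o chart_inv c).
Proof. by case: f => f /= /asboolP; apply. Qed.

Lemma smooth_partial U i (f : 'rV[R]_m -> R) : smooth_on U f ->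
  smooth_on U (partial i f).
Proof. by move=> sf k; have [_] := sf k.+1; apply. Qed.

End Extend.

(** * Values of smooth functions and of derivations *)
Section Evaluation.
Variables (R : realType) (m : nat) (M : smoothManifold R m).
Local Notation C := (smoothfun M).

Lemma smoothfun_eq (f g : C) : (forall q, f q = g q) -> f = g.
Proof. by move=> fg; apply/val_inj/funext. Qed.

Lemma vfield_eq (X Y : vfield M) : (forall f : C, X f = Y f) -> X = Y.
Proof. by move=> XY; apply/val_inj/funext. Qed.

Lemma sf0 q : (0 : C) q = 0. Proof. by []. Qed.
Lemma sfD (f g : C) q : (f + g) q = f q + g q. Proof. by []. Qed.
Lemma sfN (f : C) q : (- f) q = - f q. Proof. by []. Qed.
Lemma sfB (f g : C) q : (f - g) q = f q - g q. Proof. by []. Qed.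
Lemma sfM (f g : C) q : (f * g) q = f q * g q. Proof. by []. Qed.
Lemma sfZ a (f : C) q : (a *: f) q = a * f q. Proof. by []. Qed.
Lemma sfMn (f : C) n q : (f *+ n) q = f q *+ n.
Proof. by elim: n => [|n IH]; rewrite ?mulr0n // !mulrS sfD IH. Qed.
Lemma sf_sum n (f : 'I_n -> C) q : (\sum_i f i) q = \sum_i f i q.
Proof. exact: (big_morph (fun h : C => h q) (fun f g => sfD f g q) (sf0 q)). Qed.

Lemma vfD (X Y : vfield M) f : (X + Y) f = X f + Y f. Proof. by []. Qed.
Lemma vfB (X Y : vfield M) f : (X - Y) f = X f - Y f. Proof. by []. Qed.
Lemma vfZ (h : C) (X : vfield M) f : (h *: X) f = h * X f. Proof. by []. Qed.
Lemma vf0 f : (0 : vfield M) f = 0. Proof. by []. Qed.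
Lemma vf_sum n (X : 'I_n -> vfield M) f : (\sum_i X i) f = \sum_i X i f.
Proof.
exact: (big_morph (fun Y : vfield M => Y f : C) (fun X Y => vfD X Y f) (vf0 f)).
Qed.

Section Deriv.
Variable X : vfield M.
Lemma vf_addr f g : X (f + g) = X f + X g.
Proof. by rewrite -[f]scale1r (vfieldP X).1 !scale1r. Qed.
Lemma vf_zero : X 0 = 0.
Proof. by apply: (addIr (X 0)); rewrite -vf_addr !add0r. Qed.
Lemma vf_scaler a f : X (a *: f) = a *: X f.
Proof. by rewrite -[_ *: f]addr0 (vfieldP X).1 vf_zero addr0. Qed.
Lemma vf_subr f g : X (f - g) = X f - X g.
Proof. by rewrite vf_addr -scaleN1r vf_scaler scaleN1r. Qed.
Lemma vf_mulr f g : X (f * g) = X f * g + f * X g.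
Proof. exact: (vfieldP X).2. Qed.
Lemma vf_sumr n (f : 'I_n -> C) : X (\sum_i f i) = \sum_i X (f i).
Proof. exact: (big_morph X vf_addr vf_zero). Qed.
Lemma vf_one : X 1 = 0.
Proof.
have := vf_mulr 1 1; rewrite !mul1r mulr1 => E.
by apply: (addIr (X 1)); rewrite add0r -E.
Qed.
End Deriv.

End Evaluation.

(** * Derivations in a chart *)
Section Frame.
Variables (R : realType) (m : nat) (M : smoothManifold R m).
Local Notation C := (smoothfun M).

Lemma smooth_functionP (f : M -> R) : smooth_function f ->
  exists F : C, smoothfun_val F = f.
Proof.
move=> sf; have fP : f \in @smooth_function_pred R m M by exact/asboolP.
by exists (SmoothFun fP).
Qed.

Variables (c : chart R m M) (ac : mfd_atlas c).
Local Notation cod := (chart_map c @` chart_dom c).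
Let oc : open cod := chart_cod_open c.

Lemma smooth_extend_mul (K : set 'rV[R]_m) (k h : 'rV[R]_m -> R) :
  compact K -> K `<=` cod -> (forall x, ~ K x -> k x = 0) ->
  smooth_on setT k -> smooth_on cod h ->
  exists F : C, smoothfun_val F = extend c (k * h).
Proof.
move=> cK KU k0 sk sh; apply/smooth_functionP/(smooth_extend ac cK KU).
  by move=> x /k0 kx; rewrite -[LHS]/(k x * h x) kx mul0r.
by move=> n; apply: Ck_onM (oc) (Ck_on_sub _ (sk n)) (sh n) => ?.
Qed.

Section Field.
Variables (K : set 'rV[R]_m) (k : 'rV[R]_m -> R).
Hypotheses (cK : compact K) (KU : K `<=` cod).
Hypotheses (k0 : forall x, ~ K x -> k x = 0) (sk : smooth_on setT k).

(** The coordinate field of the chart, damped by the cut-off k so that it becomes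
    a derivation of globally defined functions. *)
Lemma chart_field_exists i : exists E : vfield M, forall f : C,
  smoothfun_val (E f) = extend c (k * partial i (f \o chart_inv c)).
Proof.
have [E0 E0E] := choice (fun f : C => smooth_extend_mul cK KU k0 sk
  (smooth_partial i (smooth_chart_fun ac f))).
have dif (f : C) q : chart_dom c q ->
    differentiable (f \o chart_inv c) (chart_map c q).
  by move=> cq; have [df _] := smooth_chart_fun ac f 1; apply: df; exists q.
have E0D : (E0 : C -> C^o) \in @derivation_pred R m M.
  apply/asboolP; split=> [a f g|f g]; apply: smoothfun_eq => q;
    rewrite ?sfD ?sfZ ?sfM !E0E; (have [cq|?] := pselect (chart_dom c q);
    last by rewrite !extend_out // ?mulr0 ?mul0r ?addr0);
    rewrite !extend_in //; set x := chart_map c q.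
  - rewrite -[LHS]/(k x * partial i (a *: (f \o chart_inv c) + (g \o chart_inv c)) x).
    rewrite -[RHS]/(a * (k x * partial i (f \o chart_inv c) x)
      + k x * partial i (g \o chart_inv c) x).
    rewrite /partial deriveD; first last.
    + exact/diff_derivable/dif.
    + exact/derivableZ/diff_derivable/dif.
    rewrite deriveZ; last exact/diff_derivable/dif.
    by rewrite -[a *: _]/(a * _); ring.
  - rewrite -[LHS]/(k x * partial i ((f \o chart_inv c) * (g \o chart_inv c)) x).
    rewrite partialM; [|exact: dif|exact: dif].
    rewrite -[RHS]/(k x * partial i (f \o chart_inv c) x * g q
      + f q * (k x * partial i (g \o chart_inv c) x)).
    by rewrite /= chart_mapK //; ring.
by exists (VField E0D).
Qed.

End Field.

(** A derivation is determined by its values on coordinate functions.  With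
    b the coordinates of q, Hadamard's lemma at b writes
    f - f(q) as a sum of (x_i - b_i) h_i; multiplied by cut-offs this becomes an
    identity between global functions to which the Leibniz rule applies at q,
    where the factors x_i - b_i vanish.  The functions psi and y_i stand for the
    cut-off versions of 1 and x_i - a_i. *)
Lemma vf_chart_expansion (X : vfield M) (K : set 'rV[R]_m) (k : 'rV[R]_m -> R)
    (a : 'rV[R]_m) (psi : C) (y : 'I_m -> C) :
  compact K -> K `<=` cod -> (forall x, ~ K x -> k x = 0) -> smooth_on setT k ->
  smoothfun_val psi = extend c k ->
  (forall i, smoothfun_val (y i) = extend c (k * (fun x => x 0 i - a 0 i))) ->
  forall (f : C) q, chart_dom c q ->
  psi q * X f q = \sum_i (X (y i) q - (chart_map c q - a) 0 i * X psi q)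
                   * partial i (f \o chart_inv c) (chart_map c q).
Proof.
move=> cK KU k0 sk psiE yE f q cq; set b := chart_map c q.
have codb : cod b by exists q.
(* A second cut-off, at q, turns f into a smooth function on all of R^m. *)
have [rho [L [srho rhob cL LU rho0]]] := bump_exists oc codb.
pose h : 'rV[R]_m -> R := (f \o chart_inv c) - cst (f q).
have sh : smooth_on cod h.
  by move=> n; apply: Ck_onB => //; [exact: smooth_chart_fun|exact: Ck_on_cst].
have hb : h b = 0 by rewrite -[LHS]/(f (chart_inv c b) - f q) /b chart_mapK // subrr.
have dfb : differentiable (f \o chart_inv c) b.
  by have [df _] := smooth_chart_fun ac f 1; apply: df.
have dh : differentiable h b by have [dh _] := sh 1%N; apply: dh.
have sF := smooth_cutoff oc cL LU srho rho0 sh.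
have [H [sH FE Hb]] := hadamard b sF.
have sHc i : smooth_on cod (H i) by move=> n; apply: Ck_on_sub (sH i n).
have [r rE] := smooth_extend_mul cL LU rho0 srho (@smooth_cst _ _ _ cod (1 : R)).
have [t tE] := choice (fun i => smooth_extend_mul cL LU rho0 srho (sHc i)).
have rEx p : chart_dom c p -> r p = rho (chart_map c p).
  by move=> cp; rewrite rE extend_in // -[LHS]/(_ * 1) mulr1.
have tEx i p : chart_dom c p -> t i p = rho (chart_map c p) * H i (chart_map c p).
  by move=> cp; rewrite tE extend_in.
have psix p : chart_dom c p -> psi p = k (chart_map c p).
  by move=> cp; rewrite psiE extend_in.
have yx i p : chart_dom c p ->
    y i p = k (chart_map c p) * (chart_map c p 0 i - a 0 i).
  by move=> cp; rewrite yE extend_in.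
have E : psi * (r * r) * (f - f q *: (1 : C)) =
    \sum_i (y i - (b - a) 0 i *: psi) * t i.
  apply: smoothfun_eq => p; rewrite sf_sum !sfM sfB sfZ.
  have [cp|ncp] := pselect (chart_dom c p); last first.
    rewrite psiE extend_out // !mul0r big1 // => i _.
    by rewrite sfM tE extend_out // mulr0.
  rewrite psix // rEx //; set x := chart_map c p.
  have e1 : (rho * h) x = rho x * (f p - f q).
    by rewrite -[LHS]/(rho x * (f (chart_inv c x) - f q)) /x chart_mapK.
  have e2 : (rho * h) b = 0 by rewrite -[LHS]/(rho b * h b) hb mulr0.
  have := FE x; rewrite e1 e2 add0r => FxE.
  rewrite -!mulrA -[(1 : C) p]/(1 : R) mulr1 FxE !mulr_sumr; apply: eq_bigr => i _.
  rewrite sfM sfB sfZ yx // psix // tEx // -/x !mxE; ring.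
have := congr1 (fun g : C => X g q) E.
rewrite vf_sumr vf_mulr vf_subr vf_scaler vf_one scaler0 subr0.
rewrite sfD !sfM sfB sfZ -[(1 : C) q]/(1 : R) mulr1 subrr mulr0 add0r sf_sum rEx // -/b.
under eq_bigr => i _.
  rewrite vf_mulr vf_subr vf_scaler sfD !sfM !sfB !sfZ yx // psix // tEx // -/b Hb.
  rewrite partialM //; last by have [dr _] := srho 1%N; exact: dr.
  rewrite hb mul0r addr0.
  have -> : partial i h b = partial i (f \o chart_inv c) b.
    rewrite /partial deriveB; [|exact: diff_derivable|exact: derivable_cst].
    by rewrite derive_cst subr0.
  rewrite (_ : k b * (b 0 i - a 0 i) - (b - a) 0 i * k b = 0); last by rewrite !mxE; ring.
  rewrite mul0r addr0; over.
move=> E2; apply: (@mulfI _ (rho b * rho b)); first by rewrite mulf_neq0.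
rewrite mulr_sumr mulrA [_ * psi q]mulrC E2; apply: eq_bigr => i _.
by rewrite !mxE; ring.
Qed.

End Frame.

(** * Local frames *)
Section LocalFrame.
Variables (R : realType) (m : nat) (M : smoothManifold R m).
Local Notation C := (smoothfun M).

(** The weight w replaces a plateau function: instead of an expansion of X
    near p, this is a global identity that is an expansion wherever w is
    nonzero.  The last clause is linear independence of the E_i at p. *)
Lemma local_frame (p : M) :
  exists (w : C) (E : 'I_m -> vfield M) (xi : vfield M -> 'I_m -> C),
  [/\ w p != 0, forall X, w *: X = \sum_i xi X i *: E i &
      forall u : 'I_m -> R, (forall f : C, \sum_i u i * E i f p = 0) ->
      forall i, u i = 0].
Proof.
have [c ac cp] := mfd_cover p; pose a := chart_map c p.
pose cod := chart_map c @` chart_dom c.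
have oc : open cod := chart_cod_open c.
have coda : cod a by exists p.
have [k [K [sk ka cK KU k0]]] := bump_exists oc coda.
have [psi psiE] := smooth_extend_mul ac cK KU k0 sk (@smooth_cst _ _ _ cod (1 : R)).
have sx j : smooth_on cod (fun x : 'rV[R]_m => x 0 j - a 0 j).
  move=> n.
  exact: (Ck_onB oc (smooth_coord j oc n) (@Ck_on_cst _ _ _ _ _ (a 0 j))).
have [y yE] := choice (fun j => smooth_extend_mul ac cK KU k0 sk (sx j)).
have [E EE] := choice (chart_field_exists ac cK KU k0 sk).
have {}psiE : smoothfun_val psi = extend c k.
  by rewrite psiE; congr extend; apply/funext => x; rewrite -[LHS]/(k x * 1) mulr1.
have psix q : chart_dom c q -> psi q = k (chart_map c q).
  by move=> cq; rewrite psiE extend_in.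
have Ex i f q : chart_dom c q ->
    E i f q = k (chart_map c q) * partial i (f \o chart_inv c) (chart_map c q).
  by move=> cq; rewrite EE extend_in.
(* psi X f = sum (X y_i - (x_i - a_i) X psi) d_i f.  One factor psi turns
   x_i - a_i into y_i, another turns d_i f into E_i f. *)
exists (psi * (psi * psi)), E, (fun X i => psi * X (y i) - y i * X psi); split.
- by rewrite !sfM psix // !mulf_neq0.
- move=> X; apply: vfield_eq => f; apply: smoothfun_eq => q.
  rewrite vf_sum sf_sum vfZ !sfM.
  have [cq|ncq] := pselect (chart_dom c q); last first.
    rewrite psiE extend_out // !mul0r big1 // => i _.
    by rewrite vfZ sfM EE (extend_out _ ncq) mulr0.
  have expand := vf_chart_expansion ac X cK KU k0 sk psiE yE f cq.
  rewrite -!mulrA expand !mulr_sumr; apply: eq_bigr => i _.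
  rewrite vfZ sfM sfB !sfM Ex // psix // yE extend_in //.
  rewrite -[(k * _) _]/(k (chart_map c q) * (chart_map c q 0 i - a 0 i)) !mxE.
  by ring.
- move=> u uE j; have := uE (y j).
  have dk : differentiable k a by have [dk _] := sk 1%N; exact: dk.
  have dx : differentiable (fun x : 'rV[R]_m => x 0 j - a 0 j) a.
    by have [dx _] := sx j 1%N; exact: dx.
  rewrite (bigD1 j) //= big1 ?addr0 => [|i ij].
    rewrite Ex // (@partial_near _ _ j _
      (k * (fun x : 'rV[R]_m => x 0 j - a 0 j)) cod) //; last first.
      by move=> x cx; rewrite /= yE extend_inv.
    rewrite partialM // partial_coord eqxx subrr mul0r addr0 mulr1 => /eqP.
    by rewrite !mulf_eq0 (negPf ka) !orbF => /eqP.
  rewrite Ex // (@partial_near _ _ i _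
    (k * (fun x : 'rV[R]_m => x 0 j - a 0 j)) cod) //; last first.
    by move=> x cx; rewrite /= yE extend_inv.
  by rewrite partialM // partial_coord (negPf ij) subrr mul0r addr0 !mulr0.
Qed.

(** Smoothness is local and stable under division; the quotient h / w is
    controlled without mentioning neighbourhoods. *)
Lemma smooth_function_local (f : M -> R) :
  (forall p, exists w h : C, w p != 0 /\ forall q, w q * f q = h q) ->
  smooth_function f.
Proof.
move=> fl c ac k; apply: Ck_on_local => _ [p cp <-].
have [w [h [wp wf]]] := fl p.
have oc := chart_cod_open c.
have cw : Ck_on k (chart_map c @` chart_dom c) (w \o chart_inv c).
  exact: smooth_chart_fun.
pose U := (chart_map c @` chart_dom c) `&` [set x | w (chart_inv c x) != 0].
have oU : open U.
  rewrite openE => x [cx wx].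
  have cwx : {for x, continuous (w \o chart_inv c)} := Ck_on_continuous cw cx.
  have n1 := open_nbhs_nbhs (conj oc cx).
  have n2 : nbhs x [set x | w (chart_inv c x) != 0].
    exact: (cvgr_neq0 _ cwx wx).
  exact: (filterI n1 n2).
exists U; split; first by split; [exists p|rewrite /= chart_mapK].
apply: (@Ck_on_eq _ _ _ _ _
  ((h \o chart_inv c) * (fun x => (w (chart_inv c x))^-1))) => //.
  move=> x [cx wx]; rewrite -[LHS]/(h (chart_inv c x) * _) -wf /=.
  by rewrite mulrAC divff // mul1r.
have sU : U `<=` chart_map c @` chart_dom c by move=> x [].
apply: Ck_onM => //; first exact/(Ck_on_sub sU)/smooth_chart_fun.
apply: Ck_onV => //; first by move=> x [].
exact: Ck_on_sub sU cw.
Qed.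

End LocalFrame.

(** * The musical isomorphism *)
Section Covariant.
Variables (R : realType) (m : nat) (M : smoothManifold R m).
Local Notation C := (smoothfun M).
Local Notation X := (vfield M).

Definition covariant1 (alpha : X -> C) : Prop :=
  forall (f : C) U V, alpha (f *: U + V) = f * alpha U + alpha V.

Section Form.
Variables (alpha : X -> C) (ha : covariant1 alpha).
Lemma oneformD U V : alpha (U + V) = alpha U + alpha V.
Proof. by rewrite -[U]scale1r ha mul1r scale1r. Qed.
Lemma oneform0 : alpha 0 = 0.
Proof. by apply: (addIr (alpha 0)); rewrite -oneformD !add0r. Qed.
Lemma oneformZ f U : alpha (f *: U) = f * alpha U.
Proof. by rewrite -[_ *: _]addr0 ha oneform0 addr0. Qed.
Lemma oneformN U : alpha (- U) = - alpha U.
Proof. by apply: (addIr (alpha U)); rewrite -oneformD !addNr oneform0. Qed.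
Lemma oneformB U V : alpha (U - V) = alpha U - alpha V.
Proof. by rewrite oneformD oneformN. Qed.
Lemma oneform_sum n (U : 'I_n -> X) : alpha (\sum_i U i) = \sum_i alpha (U i).
Proof. exact: (big_morph alpha oneformD oneform0). Qed.
End Form.

Lemma covariant2l (B : X -> X -> C) V : covariant2 B -> covariant1 (B ^~ V).
Proof. by move=> [Bl _] f U W /=; exact: Bl. Qed.

Lemma covariant2r (B : X -> X -> C) V : covariant2 B -> covariant1 (B V).
Proof. by move=> [_ Br] f U W /=; exact: Br. Qed.

End Covariant.

Section Eval.
Variables (R : realType) (m : nat) (M : smoothManifold R m) (p : M).
Definition eval_at (f : smoothfun M) : R := f p.
Lemma eval_at_is_zmod_morphism : zmod_morphism eval_at.
Proof. by []. Qed.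
Lemma eval_at_is_monoid_morphism : monoid_morphism eval_at.
Proof. by []. Qed.
HB.instance Definition _ :=
  GRing.isZmodMorphism.Build (smoothfun M) R eval_at eval_at_is_zmod_morphism.
HB.instance Definition _ :=
  GRing.isMonoidMorphism.Build (smoothfun M) R eval_at eval_at_is_monoid_morphism.
End Eval.

Section Riesz.
Variables (R : realType) (m : nat) (M : smoothManifold R m).
Local Notation C := (smoothfun M).
Local Notation X := (vfield M).
Variables (g : X -> X -> C) (hg : pseudo_riemannian g).
Let gl V := covariant2l V (pr_tensor hg).
Let gr V := covariant2r V (pr_tensor hg).

Lemma metric_inj U V : (forall W, g U W = g V W) -> U = V.
Proof.
move=> UV; apply/eqP; rewrite -subr_eq0; apply/eqP/vfield_eq => f.
apply: smoothfun_eq => q; apply: (pr_nondegenerate hg) => W.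
by rewrite (oneformB (gl W)) UV subrr.
Qed.

(** Cramer's rule for the Gram matrix G of a local frame: the adjugate exists over
    any commutative ring, so U is global and solves the system up to the factor
    det G.  At p the determinant is nonzero, since a kernel vector of G would
    be a combination of the E_i orthogonal to everything. *)
Lemma riesz_local (alpha : X -> C) (p : M) : covariant1 alpha ->
  exists (U : X) (w : C), w p != 0 /\ forall V, g U V = w * alpha V.
Proof.
move=> ha; have [w0 [E [xi [w0p wE Eind]]]] := local_frame p.
pose G : 'M[C]_m := \matrix_(i, j) g (E i) (E j).
have expand (be : X -> C) V : covariant1 be ->
    w0 * be V = \sum_k xi V k * be (E k).
  move=> hb; rewrite -(oneformZ hb) wE (oneform_sum hb).
  by apply: eq_bigr => k _; rewrite (oneformZ hb).
pose v := (\row_j alpha (E j)) *m \adj G.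
pose U := \sum_i v 0 i *: E i.
have UE k : g U (E k) = \det G * alpha (E k).
  rewrite (oneform_sum (gl (E k))); transitivity ((v *m G) 0 k).
    rewrite mxE; apply: eq_bigr => i _; rewrite (oneformZ (gl (E k))).
    by rewrite [G i k]mxE.
  by rewrite -mulmxA mul_adj_mx mul_mx_scalar !mxE.
exists (w0 *: U), (w0 * \det G); split; last first.
  move=> V; rewrite (oneformZ (gl V)) (expand _ V (gr U)) mulrAC (expand _ V ha).
  by rewrite mulr_suml; apply: eq_bigr => k _; rewrite UE mulrCA mulrC.
rewrite sfM mulf_neq0 // -[_ p]/(eval_at p (\det G)) -det_map_mx.
apply/negP => /det0P[u u0 uG]; move/negP: u0; apply; apply/eqP/rowP => i.
rewrite mxE; apply: (Eind (u 0)) => f.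
pose W := \sum_i (u 0 i *: (1 : C)) *: E i.
have -> : \sum_i u 0 i * E i f p = W f p.
  rewrite vf_sum sf_sum; apply: eq_bigr => j _.
  by rewrite vfZ sfM sfZ -[(1 : C) p]/(1 : R) mulr1.
apply: (pr_nondegenerate hg) => V; apply: (mulfI w0p); rewrite mulr0 -sfM.
rewrite expand; last exact: gr.
rewrite sf_sum big1 // => k _; rewrite sfM (oneform_sum (gl (E k))) sf_sum.
transitivity (xi V k p * (u *m map_mx (eval_at p) G) 0 k); last first.
  by rewrite uG mxE mulr0.
congr (_ * _); rewrite mxE; apply: eq_bigr => j _.
by rewrite (oneformZ (gl (E k))) sfM sfZ -[(1 : C) p]/(1 : R) mulr1 !mxE.
Qed.

(** The local solutions L p, divided by their weights, agree pointwise: at q the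
    tangent vector dual to alpha is unique by nondegeneracy. *)
Lemma riesz (alpha : X -> C) : covariant1 alpha ->
  exists U : X, forall V, g U V = alpha V.
Proof.
move=> ha.
have [L LP] := choice (fun p => riesz_local p ha).
have [w wP] := choice LP.
have wL q : w q q != 0 by have [] := wP q.
have gL q V : g (L q) V = w q * alpha V by have [_ ->] := wP q.
(* At q both sides are the derivation dual to the value of w p * alpha. *)
have scaled p q f : w p q * (L q f q / w q q) = L p f q.
  pose D := (w p q *: (1 : C)) *: L q - (w q q *: (1 : C)) *: L p.
  have : D f q = 0.
    apply: (pr_nondegenerate hg) => V.
    rewrite (oneformB (gl V)) !(oneformZ (gl V)) !gL sfB !sfM !sfZ.
    by rewrite -[(1 : C) q]/(1 : R); ring.
  rewrite vfB sfB !vfZ !sfM !sfZ -[(1 : C) q]/(1 : R) !mulr1 => /eqP.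
  by rewrite subr_eq0 => /eqP E; rewrite mulrA E mulrAC divff ?mul1r.
have sU (f : C) : exists F : C, smoothfun_val F = fun q => L q f q / w q q.
  apply/smooth_functionP/smooth_function_local => p.
  by exists (w p), (L p f); split.
have [U0 U0E] := choice sU.
have U0D : (U0 : C -> C^o) \in @derivation_pred R m M.
  apply/asboolP; split=> [a f h|f h]; apply: smoothfun_eq => q.
    by rewrite sfD sfZ !U0E (vfieldP (L q)).1 sfD sfZ mulrDl mulrA.
  by rewrite sfD !sfM !U0E vf_mulr sfD !sfM; ring.
pose U := VField U0D.
have UL p : w p *: U = L p.
  apply: vfield_eq => f; apply: smoothfun_eq => q.
  by rewrite vfZ sfM -(scaled p q f) -[U f]/(U0 f) U0E.
exists U => V; apply: smoothfun_eq => p; apply: (mulfI (wL p)).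
by rewrite -!sfM -(oneformZ (gl V)) UL gL.
Qed.

Lemma riesz_family (B : X -> X -> C) : (forall U, covariant1 (B U)) ->
  exists T : X -> X, forall U V, g (T U) V = B U V.
Proof.
by move=> hB; have [T TP] := choice (fun U => riesz (hB U)); exists T.
Qed.

End Riesz.

(** * The Levi-Civita connection *)
Section Lie.
Variables (R : realType) (m : nat) (M : smoothManifold R m).
Local Notation C := (smoothfun M).
Local Notation X := (vfield M).

Lemma lieE (U V : X) f : lie U V f = U (V f) - V (U f).
Proof. by []. Qed.

Lemma lieC (U V : X) : lie U V = - lie V U.
Proof. by apply: vfield_eq => f; rewrite -[RHS]/(- (lie V U f)) !lieE opprB. Qed.

Lemma lie_addl (U V W : X) : lie (U + V) W = lie U W + lie V W.
Proof.
by apply: vfield_eq => f; rewrite vfD !lieE !vfD vf_addr; ring.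
Qed.

Lemma lie_addr (U V W : X) : lie U (V + W) = lie U V + lie U W.
Proof. by rewrite lieC lie_addl opprD -!lieC. Qed.

Lemma lie_mulr f (U V : X) : lie U (f *: V) = U f *: V + f *: lie U V.
Proof.
by apply: vfield_eq => h; rewrite vfD !vfZ !lieE !vfZ vf_mulr; ring.
Qed.

Lemma lie_mull f (U V : X) : lie (f *: U) V = f *: lie U V - V f *: U.
Proof. by rewrite lieC lie_mulr opprD addrC -scalerN -lieC. Qed.

End Lie.

Section LeviCivita.
Variables (R : realType) (m : nat) (M : smoothManifold R m).
Local Notation C := (smoothfun M).
Local Notation X := (vfield M).
Variables (g : X -> X -> C) (hg : pseudo_riemannian g).

Lemma riesz_family2 (K : X -> X -> X -> C) : (forall U V, covariant1 (K U V)) ->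
  exists T : X -> X -> X, forall U V W, g (T U V) W = K U V W.
Proof.
by move=> hK; have [T TP] := choice (fun U => riesz_family hg (hK U)); exists T.
Qed.

Let gDl U V W : g (U + V) W = g U W + g V W.
Proof. exact: (oneformD (covariant2l W (pr_tensor hg)) _ _). Qed.
Let gZl f U W : g (f *: U) W = f * g U W.
Proof. exact: (oneformZ (covariant2l W (pr_tensor hg)) _ _). Qed.
Let gNl U W : g (- U) W = - g U W.
Proof. exact: (oneformN (covariant2l W (pr_tensor hg)) _). Qed.
Let g0l W : g 0 W = 0.
Proof. exact: (oneform0 (covariant2l W (pr_tensor hg))). Qed.
Let gDr U V W : g W (U + V) = g W U + g W V.
Proof. exact: (oneformD (covariant2r W (pr_tensor hg)) _ _). Qed.
Let gZr f U W : g W (f *: U) = f * g W U.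
Proof. exact: (oneformZ (covariant2r W (pr_tensor hg)) _ _). Qed.

(** Koszul's formula, the value forced on g (nab U V) W by metricity and
    vanishing torsion. *)
Definition koszul (U V W : X) : C :=
  2%:R^-1 *: (U (g V W) + V (g U W) - W (g U V)
              + g (lie U V) W - g (lie U W) V - g (lie V W) U).

Lemma levi_civita_exists : exists nab, levi_civita g nab.
Proof.
have [nab nabE] : exists T, forall U V W, g (T U V) W = koszul U V W.
  apply: riesz_family2 => U V f W W'; apply: smoothfun_eq => q.
  rewrite /koszul !lie_addr !lie_mulr !gDl !gDr !gZl !gZr.
  rewrite !vf_addr !vf_mulr !vfD !vfZ.
  rewrite !(sfD, sfN, sfZ, sfM) (pr_sym hg W V) (pr_sym hg W U).
  by ring.
have sym U V (W : X) : W (g U V) = W (g V U) by rewrite (pr_sym hg).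
exists nab; split.
- split.
  + move=> f U V W; apply: (metric_inj hg) => Z; apply: smoothfun_eq => q.
    rewrite gDl gZl !nabE /koszul !lie_addl !lie_mull !gDl !gNl !gZl !gDr !gZr.
    rewrite !vf_addr !vf_mulr !vfD !vfZ !(sfD, sfN, sfZ, sfM).
    by ring.
  + move=> U V W; apply: (metric_inj hg) => Z; apply: smoothfun_eq => q.
    rewrite gDl !nabE /koszul !lie_addl !lie_addr !gDl !gDr.
    by rewrite !vf_addr !vfD !(sfD, sfN, sfZ, sfM); ring.
  + move=> f U V; apply: (metric_inj hg) => Z; apply: smoothfun_eq => q.
    rewrite gDl !gZl !nabE /koszul !lie_mull !lie_mulr !gDl !gNl !gZl !gZr.
    rewrite !vf_mulr !vfZ !(sfD, sfN, sfZ, sfM).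
    by rewrite (pr_sym hg V U); field.
- move=> U V W; apply: smoothfun_eq => q; rewrite /nabla2.
  rewrite [g V (nab U W)](pr_sym hg) !nabE /koszul !(sfD, sfN, sfZ, sfM) (sym W V U).
  by rewrite (lieC W V) !gNl sfN sf0; lra.
- move=> U V; apply: (metric_inj hg) => W; apply: smoothfun_eq => q.
  rewrite /torsion !gDl !gNl !nabE /koszul !(sfD, sfN, sfZ, sfM) (sym V U).
  by rewrite (lieC V U) !gNl sfN g0l sf0; lra.
Qed.
End LeviCivita.

(** * Connections on almost para-Hermitian manifolds *)
Section Connections.
Variables (R : realType) (m : nat) (M : smoothManifold R m).
Local Notation C := (smoothfun M).
Local Notation X := (vfield M).

Lemma torsionC (nab : X -> X -> X) U V : torsion nab U V = - torsion nab V U.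
Proof. by rewrite /torsion (lieC U V) opprD opprB opprK. Qed.

Lemma lie_torsion (nab : X -> X -> X) U V :
  lie U V = nab U V - nab V U - torsion nab U V.
Proof. by rewrite /torsion subKr. Qed.

(** Replacing brackets by covariant derivatives, the derivatives of the arguments
    cancel by skewness and only the torsion remains. *)
Lemma ext_d_torsion (nab : X -> X -> X) (B : X -> X -> C) U V W :
  covariant2 B -> (forall U V, B U V = - B V U) ->
  ext_d B U V W =
    nabla2 nab B U V W + nabla2 nab B V W U + nabla2 nab B W U V
    + (B (torsion nab U V) W + B (torsion nab V W) U + B (torsion nab W U) V).
Proof.
move=> cB Bskew; rewrite /ext_d /nabla2 !(lie_torsion nab).
have BB P Q Z := oneformB (covariant2l Z cB) P Q; rewrite !BB.
by rewrite [B V (nab U W)]Bskew [B W (nab V U)]Bskew [B U (nab W V)]Bskew; ring.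
Qed.

(** All five nontrivial permutations are listed so that linear arithmetic can be
    fed with them directly; the values are pointwise, hence in R. *)
Definition alternating3 (t : X -> X -> X -> R) : Prop := forall U V W,
  [/\ t V U W = - t U V W, t U W V = - t U V W, t W V U = - t U V W,
      t V W U = t U V W & t W U V = t U V W].

Lemma alternating3P (t : X -> X -> X -> R) :
  (forall U V W, t V U W = - t U V W) -> (forall U V W, t U W V = - t U V W) ->
  alternating3 t.
Proof.
move=> t12 t23 U V W; split=> //.
- by rewrite t12 t23 t12 opprK.
- by rewrite t23 t12 opprK.
- by rewrite t12 t23 opprK.
Qed.

Section ParaHermitian.
Variables (A : X -> X) (g : X -> X -> C) (hA : almost_para_hermitian A g).
Let hg := aph_metric hA.
Local Notation F := (kahler_form A g).
Local Notation dF := (ext_d F).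
Local Notation G := (gen_metric A g).

Let gl V := covariant2l V (pr_tensor hg).
Let gr V := covariant2r V (pr_tensor hg).
Let gC := pr_sym hg.
Let AA := aph_invol hA.

Lemma aph_adjoint U V : g (A U) V = - g U (A V).
Proof. by rewrite -{1}[V]AA (aph_compat hA). Qed.

Lemma aph_add U V : A (U + V) = A U + A V.
Proof. by rewrite -[U]scale1r (aph_tensor hA) !scale1r. Qed.

Lemma kahler_skew U V : F U V = - F V U.
Proof. by rewrite /kahler_form aph_adjoint gC. Qed.

Lemma kahler_covariant : covariant2 F.
Proof.
split=> f U V W; rewrite /kahler_form; last exact: gr.
by rewrite (aph_tensor hA); exact: gl.
Qed.

Section Nabla.
Variable nab : X -> X -> X.
Local Notation a U V W := (g (nabla_endo nab A U V) W).

Lemma nabla_endoE U V W : a U V W = g (nab U (A V)) W + g (nab U V) (A W).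
Proof. by rewrite /nabla_endo (oneformB (gl W)) aph_adjoint opprK. Qed.

Lemma nabla_endo_nabla2 U V W :
  a U V W = nabla2 nab F U V W - nabla2 nab g U (A V) W.
Proof.
by rewrite nabla_endoE /nabla2 /kahler_form [g (A (nab U V)) W]aph_adjoint; ring.
Qed.

(** Unfolding the torsions on the right brings back the four brackets of N, and all
    covariant derivatives cancel. *)
Lemma nijenhuis_torsion U V W :
  lower g (nijenhuis A) U V W =
    a (A U) V W - a (A V) U W + a U V (A W) - a V U (A W)
    - (lower g (torsion nab) (A U) (A V) W + lower g (torsion nab) U V W
       + lower g (torsion nab) (A U) V (A W) + lower g (torsion nab) U (A V) (A W)).
Proof.
rewrite !nabla_endoE /lower /nijenhuis /torsion !AA.
rewrite !(oneformD (gl _), oneformN (gl _)) !aph_adjoint.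
by ring.
Qed.

Lemma nabla2_gen_metric U V W :
  nabla2 nab G U V W = nabla2 nab g U V W + nabla2 nab F U V W.
Proof. by rewrite /nabla2 /gen_metric vf_addr; ring. Qed.

Lemma nabla2_kahlerE U V W :
  nabla2 nab F U V W = U (F V W) + g (nab U V) (A W) - g (nab U W) (A V).
Proof.
rewrite /nabla2 /kahler_form [g (A (nab U V)) W]aph_adjoint.
by rewrite [g (A V) (nab U W)]gC; ring.
Qed.

End Nabla.

Lemma lower_torsionC nab U V W :
  lower g (torsion nab) V U W = - lower g (torsion nab) U V W.
Proof. by rewrite /lower torsionC (oneformN (gl W)). Qed.

Lemma nabla2_metricC nab' U V W : nabla2 nab' g U V W = nabla2 nab' g U W V.
Proof.
by rewrite /nabla2 [g V W]gC [g V (nab' _ _)]gC [g W (nab' _ _)]gC addrAC.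
Qed.

Lemma nabla2_kahlerC nab' U V W : nabla2 nab' F U V W = - nabla2 nab' F U W V.
Proof.
rewrite !nabla2_kahlerE (kahler_skew V W) -[- F W V]scaleN1r vf_scaler scaleN1r.
by ring.
Qed.

Lemma levi_civita_torsion nab nabg U V W : levi_civita g nabg ->
  lower g (torsion nab) U V W =
    g (nab U V) W - g (nab V U) W - (g (nabg U V) W - g (nabg V U) W).
Proof.
move=> [_ _ tg]; have := tg U V.
rewrite /torsion => /eqP; rewrite subr_eq0 => /eqP e.
by rewrite /lower /torsion -e !(oneformB (gl W)).
Qed.

Lemma difference_metric nab nabg q U V W : levi_civita g nabg ->
  nabla2 nab g U V W q =
    - (g (nab U V) W q - g (nabg U V) W q
       + (g (nab U W) V q - g (nabg U W) V q)).
Proof.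
move=> [_ mg _]; have := congr1 (fun f : C => f q) (mg U V W).
rewrite /nabla2 [g V (nab _ _)]gC [g V (nabg _ _)]gC !(sfD, sfN) sf0; lra.
Qed.

(** * Einstein connections with totally skew torsion *)
Section EinsteinConnection.
Variable nab : X -> X -> X.
Hypothesis einstein : einstein_metricity G nab.
Hypothesis skewT : totally_skew g (torsion nab).
Local Notation T := (lower g (torsion nab)).

Lemma torsion_alternating q : alternating3 (fun U V W => T U V W q).
Proof.
apply: alternating3P => U V W; first by rewrite lower_torsionC.
by rewrite [in LHS]skewT.
Qed.

Lemma einstein_nabla2_gen_metric U V W :
  nabla2 nab G U V W = T U V (A W) - T U V W.
Proof.
by rewrite einstein /gen_metric /kahler_form aph_adjoint opprD opprK addrC.
Qed.

Lemma einstein_nabla2_sum q U V W :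
  nabla2 nab g U V W q + nabla2 nab F U V W q = T U V (A W) q - T U V W q.
Proof. by rewrite -sfD -nabla2_gen_metric einstein_nabla2_gen_metric. Qed.

(** The symmetric part in (V, W) of the metricity condition; the term T(U, V, W)
    drops out because it is skew. *)
Lemma einstein_nabla2_metric q U V W :
  nabla2 nab g U V W q = 2%:R^-1 * (T U V (A W) q - T U (A V) W q).
Proof.
have e1 := einstein_nabla2_sum q U V W; have := einstein_nabla2_sum q U W V.
rewrite (nabla2_metricC _ U W V) (nabla2_kahlerC _ U W V) sfN => e2.
have [_ s1 _ _ _] := torsion_alternating q U V W.
have [_ s2 _ _ _] := torsion_alternating q U (A V) W.
lra.
Qed.

Lemma einstein_nabla2_kahler q U V W :
  nabla2 nab F U V W q =
    2%:R^-1 * (T U V (A W) q + T U (A V) W q) - T U V W q.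
Proof.
have := einstein_nabla2_sum q U V W.
by rewrite einstein_nabla2_metric; lra.
Qed.

(** In dF the cyclic sum of nab F contributes - 3 T plus the sum of T with A in
    each slot; the cyclic sum of F (T) contributes minus that same sum. *)
Lemma einstein_torsion q U V W : T U V W q = - (3%:R^-1 * dF U V W q).
Proof.
have := congr1 (fun f : C => f q)
  (ext_d_torsion nab U V W kahler_covariant kahler_skew).
have FT P Q Z : F (torsion nab P Q) Z = - T P Q (A Z) by exact: aph_adjoint.
rewrite !FT => dFE.
have {dFE} : dF U V W q = nabla2 nab F U V W q + nabla2 nab F V W U q
    + nabla2 nab F W U V q
    + (- T U V (A W) q + - T V W (A U) q + - T W U (A V) q) := dFE.
rewrite !einstein_nabla2_kahler.
have [_ _ _ e1 e2] := torsion_alternating q U V W.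
have [_ _ _ e3 _] := torsion_alternating q U V (A W).
have [_ _ _ _ e4] := torsion_alternating q U (A V) W.
have [_ _ _ e5 e6] := torsion_alternating q (A U) V W.
by rewrite e1 e2 e3 e4 e5 e6; lra.
Qed.

Lemma einstein_nabla_endo q U V W : g (nabla_endo nab A U V) W q =
  2%:R^-1 * (T U V (A W) q + T U (A V) W q - T U V W q - T U (A V) (A W) q).
Proof.
have -> : g (nabla_endo nab A U V) W q =
    nabla2 nab F U V W q - nabla2 nab g U (A V) W q.
  by rewrite nabla_endo_nabla2.
by rewrite einstein_nabla2_kahler einstein_nabla2_metric AA; lra.
Qed.

Lemma einstein_nijenhuis q U V W :
  lower g (nijenhuis A) U V W q =
    - (T (A U) V W q + T U (A V) W q + T U V (A W) q + T (A U) (A V) (A W) q).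
Proof.
rewrite (nijenhuis_torsion nab) !(sfD, sfN).
rewrite !einstein_nabla_endo !AA.
have [e1 _ _ _ _] := torsion_alternating q (A U) V W.
have [e2 _ _ _ _] := torsion_alternating q U (A V) W.
have [e3 _ _ _ _] := torsion_alternating q U V (A W).
have [e4 _ _ _ _] := torsion_alternating q U V W.
have [e5 _ _ _ _] := torsion_alternating q (A U) (A V) W.
have [e6 _ _ _ _] := torsion_alternating q (A U) V (A W).
have [e7 _ _ _ _] := torsion_alternating q U (A V) (A W).
have [e8 _ _ _ _] := torsion_alternating q (A U) (A V) (A W).
by rewrite e1 e2 e3 e4 e5 e6 e7 e8; lra.
Qed.

Lemma einstein_nijenhuis_skew : totally_skew g (nijenhuis A).
Proof.
move=> U V W; apply: smoothfun_eq => q; rewrite sfN !einstein_nijenhuis.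
have [_ e1 _ _ _] := torsion_alternating q (A U) V W.
have [_ e2 _ _ _] := torsion_alternating q U (A V) W.
have [_ e3 _ _ _] := torsion_alternating q U V (A W).
have [_ e4 _ _ _] := torsion_alternating q (A U) (A V) (A W).
by rewrite e1 e2 e3 e4; lra.
Qed.

Section CompareLeviCivita.
Variable nabg : X -> X -> X.
Hypothesis lcg : levi_civita g nabg.
Local Notation D U V W q := (g (nab U V) W q - g (nabg U V) W q).

(** D is skew up to T in its first two slots and symmetric up to nab g in its last
    two, so cyclic permutation determines it, as in Koszul's formula. *)
Lemma difference_formula q U V W : D U V W q =
  2%:R^-1 * (T U V W q + T U (A V) W q - T (A U) V W q).
Proof.
have t P Q Z : T P Q Z q = D P Q Z q - D Q P Z q.
  by rewrite (levi_civita_torsion nab P Q Z lcg) !(sfD, sfN); ring.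
have mt P Q Z := etrans (esym (difference_metric nab q P Q Z lcg))
  (einstein_nabla2_metric q P Q Z).
have [_ s1 s2 s3 s4] := torsion_alternating q U V W.
have [r0 r1 r2 r3 r4] := torsion_alternating q (A U) V W.
have [p0 p1 p2 p3 p4] := torsion_alternating q U (A V) W.
have [n0 n1 n2 n3 n4] := torsion_alternating q U V (A W).
have t1 := t U V W; have t2 := t V W U; have t3 := t W U V.
have m1 := mt U V W; have m2 := mt V W U; have m3 := mt W U V.
lra.
Qed.

End CompareLeviCivita.
End EinsteinConnection.
End ParaHermitian.
End Connections.

(** * Existence from a totally skew Nijenhuis tensor *)
Section Existence.
Variables (R : realType) (m : nat) (M : smoothManifold R m).
Local Notation C := (smoothfun M).
Local Notation X := (vfield M).
Variables (A : X -> X) (g : X -> X -> C) (hA : almost_para_hermitian A g).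
Let hg := aph_metric hA.
Local Notation F := (kahler_form A g).
Local Notation dF := (ext_d F).
Local Notation G := (gen_metric A g).
Let gl V := covariant2l V (pr_tensor hg).
Let gr V := covariant2r V (pr_tensor hg).
Let AA := aph_invol hA.
Variables (nabg : X -> X -> X) (lcg : levi_civita g nabg).
Local Notation a U V W := (g (nabla_endo nabg A U V) W).

Lemma levi_civita_nabla_endo U V W : a U V W = nabla2 nabg F U V W.
Proof. by have [_ mg _] := lcg; rewrite (nabla_endo_nabla2 hA) mg subr0. Qed.

Lemma nabla_endo_skew U V W : a U W V = - a U V W.
Proof. by rewrite !levi_civita_nabla_endo (nabla2_kahlerC hA). Qed.

Lemma nabla_endo_swap U V W : a U (A V) W = a U V (A W).
Proof. by rewrite !(nabla_endoE hA) !AA addrC. Qed.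

Lemma nabla_endo_linearl f U U' V : nabla_endo nabg A (f *: U + U') V =
  f *: nabla_endo nabg A U V + nabla_endo nabg A U' V.
Proof.
have [[lin _ _] _ _] := lcg.
by rewrite /nabla_endo !lin (aph_tensor hA) scalerBr opprD addrACA.
Qed.

Lemma nabla_endo_linearr f U V V' : nabla_endo nabg A U (f *: V + V') =
  f *: nabla_endo nabg A U V + nabla_endo nabg A U V'.
Proof.
have [[_ add lei] _ _] := lcg; apply: (metric_inj hg) => W.
rewrite (gl W f (nabla_endo nabg A U V) (nabla_endo nabg A U V')).
rewrite !(nabla_endoE hA) (aph_tensor hA) !add !lei.
rewrite !(oneformD (gl _), oneformZ (gl _)) (aph_adjoint hA).
by ring.
Qed.

(** Besides computing dF, this shows that dF is tensorial and alternating, which is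
    not apparent from its definition by derivatives and brackets. *)
Lemma levi_civita_ext_d U V W : dF U V W = a U V W + a V W U + a W U V.
Proof.
have [_ _ tg] := lcg.
rewrite (ext_d_torsion nabg _ _ _ (kahler_covariant hA) (kahler_skew hA)) !tg.
have F0 Z : F 0 Z = 0 by exact: (oneform0 (covariant2l Z (kahler_covariant hA))).
by rewrite !F0 !addr0 !levi_civita_nabla_endo.
Qed.

Lemma ext_d_alternating q : alternating3 (fun U V W => dF U V W q).
Proof.
apply: alternating3P => U V W; rewrite !levi_civita_ext_d;
  rewrite (nabla_endo_skew U V W) (nabla_endo_skew V W U) (nabla_endo_skew W U V);
  by rewrite !(sfD, sfN); ring.
Qed.

Lemma ext_d_linear1 f U U' V W :
  dF (f *: U + U') V W = f * dF U V W + dF U' V W.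
Proof.
rewrite !levi_civita_ext_d nabla_endo_linearl nabla_endo_linearr.
by rewrite !(gl _) !(gr _); ring.
Qed.

Lemma ext_d_linear2 f U U' V W :
  dF V (f *: U + U') W = f * dF V U W + dF V U' W.
Proof.
rewrite !levi_civita_ext_d nabla_endo_linearl nabla_endo_linearr.
by rewrite !(gl _) !(gr _); ring.
Qed.

Lemma ext_d_linear3 f U U' V W :
  dF V W (f *: U + U') = f * dF V W U + dF V W U'.
Proof.
rewrite !levi_civita_ext_d nabla_endo_linearl nabla_endo_linearr.
by rewrite !(gl _) !(gr _); ring.
Qed.

Hypothesis skewN : totally_skew g (nijenhuis A).

Lemma nijenhuis_levi_civita U V W : lower g (nijenhuis A) U V W =
  a (A U) V W - a (A V) U W + a U V (A W) - a V U (A W).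
Proof.
have [_ _ tg] := lcg.
rewrite (nijenhuis_torsion hA nabg) /lower !tg.
by rewrite !(oneform0 (gl _)) !addr0 subr0.
Qed.

(** Let c(U, V, W) = a(A U, V, W) + a(U, V, A W).  It is skew in its last two
    slots, and N(U, V, W) = c(U, V, W) - c(V, U, W), so skewness of N forces c to be
    totally skew.  The claim, with dF expanded in a, is
    2 c(U, V, A W) = c(V, A W, U) + c(W, U, A V), and
    c(W, U, A V) = c(A W, U, V). *)
Lemma skew_nijenhuis_nabla_endo q U V W : a U V W q =
  3%:R^-1 * dF U V W q + 3%:R^-1 * dF U (A V) (A W) q
  - 6%:R^-1 * dF (A U) V (A W) q - 6%:R^-1 * dF (A U) (A V) W q.
Proof.
have H P Q Z : a (A P) Z Q q + a P Z (A Q) q + a (A Q) Z P q + a Q Z (A P) q = 0.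
  have := congr1 (fun f : C => f q) (skewN Z P Q).
  rewrite sfN !nijenhuis_levi_civita !(sfD, sfN).
  rewrite (nabla_endo_skew (A Z) P Q) (nabla_endo_skew Z (A P) Q).
  rewrite (nabla_endo_swap Z P Q) !sfN; lra.
have skew P Q Z : a P Z Q q = - a P Q Z q by rewrite nabla_endo_skew.
have swap P Q Z : a P (A Q) Z q = a P Q (A Z) q by rewrite nabla_endo_swap.
(* The cyclic symmetry of c on the triple U, V, A W takes two transpositions. *)
have H1 := H U (A W) V; have H2 := H (A W) V U; rewrite !AA in H1 H2.
rewrite !levi_civita_ext_d !(sfD, sfN).
rewrite (swap U V (A W)) (swap V W (A U)) (swap W U (A V)) !AA.
rewrite (swap (A W) U V) (swap (A U) V W) (swap (A V) W U).
have s1 := skew W U V; have s2 := skew (A W) (A U) V; have s3 := skew V W U.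
have s4 := skew (A V) (A W) U; rewrite !swap in s2 s4.
lra.
Qed.

(** The tensor S added to the Levi-Civita connection is the difference that
    [difference_formula] prescribes once T = - dF / 3. *)
Lemma einstein_connection_exists : exists nab : X -> X -> X,
  [/\ linear_connection nab, einstein_metricity G nab &
      totally_skew g (torsion nab)].
Proof.
pose K U V W := 6%:R^-1 *: (dF (A U) V W - dF U V W - dF U (A V) W).
have [S SE] : exists S : X -> X -> X, forall U V W, g (S U V) W = K U V W.
  apply: (riesz_family2 hg) => U V f W W'; apply: smoothfun_eq => q.
  by rewrite /K !ext_d_linear3 !(sfD, sfN, sfZ, sfM); ring.
have SEq U V W q : g (S U V) W q =
    6%:R^-1 * (dF (A U) V W q - dF U V W q - dF U (A V) W q) by rewrite SE.
have [[lin add lei] mg tg] := lcg.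
have Sl f U U' V : S (f *: U + U') V = f *: S U V + S U' V.
  apply: (metric_inj hg) => W; rewrite (gl W f (S U V) (S U' V)) !SE /K.
  rewrite (aph_tensor hA) !ext_d_linear1; apply: smoothfun_eq => q.
  by rewrite !(sfD, sfN, sfZ, sfM); ring.
have Sr f U V V' : S U (f *: V + V') = f *: S U V + S U V'.
  apply: (metric_inj hg) => W; rewrite (gl W f (S U V) (S U V')) !SE /K.
  rewrite (aph_tensor hA) !ext_d_linear2; apply: smoothfun_eq => q.
  by rewrite !(sfD, sfN, sfZ, sfM); ring.
pose nab U V := nabg U V + S U V.
have TE U V W q : lower g (torsion nab) U V W q = - (3%:R^-1 * dF U V W q).
  have -> : lower g (torsion nab) U V W q = g (S U V) W q - g (S V U) W q.
    rewrite -sfB -(oneformB (gl W)) /lower; congr (g _ W q).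
    have := tg U V; rewrite /torsion /nab => /eqP; rewrite subr_eq0 => /eqP <-.
    by rewrite opprD addrACA [LHS]addrAC subrr add0r.
  rewrite !SEq.
  have [e1 _ _ _ _] := ext_d_alternating q U V W.
  have [e2 _ _ _ _] := ext_d_alternating q (A U) V W.
  have [e3 _ _ _ _] := ext_d_alternating q U (A V) W.
  by rewrite e1 e2 e3; lra.
exists nab; split.
- split.
  + by move=> f U V W; rewrite /nab lin Sl scalerDr addrACA.
  + by move=> U V W; rewrite /nab add -[V]scale1r Sr !scale1r addrACA.
  + move=> f U V; rewrite /nab lei.
    have S0 : S U 0 = 0.
      by apply: (addIr (S U 0)); have := Sr 1 U 0 0; rewrite !scale1r !add0r => <-.
    by have := Sr f U V 0; rewrite !addr0 S0 addr0 => ->; rewrite scalerDr addrA.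
- move=> U V W; apply: smoothfun_eq => q.
  have -> : nabla2 nab G U V W q = a U V W q - (g (S U V) W q - g (S U V) (A W) q)
     - (g (S U W) V q + g (S U W) (A V) q).
    have GD U' V' W' : G (U' + V') W' = G U' W' + G V' W'.
      by rewrite /gen_metric /kahler_form (aph_add hA) !(oneformD (gl _)) addrACA.
    have GDr U' V' W' : G U' (V' + W') = G U' V' + G U' W'.
      by rewrite /gen_metric /kahler_form !(oneformD (gr _)) addrACA.
    have GS : G (S U V) W = g (S U V) W - g (S U V) (A W).
      by rewrite /gen_metric /kahler_form (aph_adjoint hA).
    have GSr : G V (S U W) = g (S U W) V + g (S U W) (A V).
      by rewrite /gen_metric /kahler_form !(pr_sym hg (S U W)).
    have : nabla2 nabg G U V W = a U V W.
      by rewrite nabla2_gen_metric mg add0r levi_civita_nabla_endo.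
    rewrite /nabla2 /nab GD GDr GS GSr => <-.
    by rewrite !(sfD, sfN); ring.
  have -> : (- G (torsion nab U V) W) q = lower g (torsion nab) U V (A W) q
     - lower g (torsion nab) U V W q.
    rewrite -sfB; congr (smoothfun_val _ q).
    by rewrite /gen_metric /kahler_form (aph_adjoint hA) opprD opprK addrC.
  rewrite !TE skew_nijenhuis_nabla_endo !SEq.
  have [e1 e1' _ _ _] := ext_d_alternating q U V W.
  have [e2 e2' _ _ _] := ext_d_alternating q (A U) V W.
  have [_ e3 _ _ _] := ext_d_alternating q U (A V) W.
  have [_ e4 _ _ _] := ext_d_alternating q U V (A W).
  have [_ e5 _ _ _] := ext_d_alternating q (A U) (A V) W.
  have [_ e6 _ _ _] := ext_d_alternating q (A U) V (A W).
  have [_ e7 _ _ _] := ext_d_alternating q U (A V) (A W).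
  lra.
- move=> U V W; apply: smoothfun_eq => q; rewrite sfN !TE.
  have [_ e1 _ _ _] := ext_d_alternating q U V W.
  by rewrite e1; lra.
Qed.

End Existence.

Theorem theorem3p3 (R : realType) (m : nat) (M : smoothManifold R m)
    (A : vfield M -> vfield M) (g : vfield M -> vfield M -> smoothfun M)
    (hA : almost_para_hermitian A g) :
  let F := kahler_form A g in
  let G := gen_metric A g in
  let dF := ext_d F in
  ((exists nab : vfield M -> vfield M -> vfield M,
      [/\ linear_connection nab, einstein_metricity G nab &
          totally_skew g (torsion nab)])
   <-> totally_skew g (nijenhuis A))
  /\
  (forall nab : vfield M -> vfield M -> vfield M,
     linear_connection nab -> einstein_metricity G nab ->
     totally_skew g (torsion nab) ->
     forall X Y Z : vfield M,
     [/\ lower g (torsion nab) X Y Z = - (3%:R^-1 *: dF X Y Z),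
         nabla2 nab G X Y Z = 3%:R^-1 *: (dF X Y Z - dF X Y (A Z)),
         nabla2 nab g X Y Z = - (6%:R^-1 *: (dF X Y (A Z) - dF X (A Y) Z)),
         nabla2 nab F X Y Z =
           6%:R^-1 *: (dF X Y Z *+ 2 - dF X Y (A Z) - dF X (A Y) Z) &
         forall nabg : vfield M -> vfield M -> vfield M, levi_civita g nabg ->
         [/\ g (nab X Y) Z =
               g (nabg X Y) Z - 6%:R^-1 *: dF X Y Z
               - 6%:R^-1 *: dF X (A Y) Z + 6%:R^-1 *: dF (A X) Y Z,
             nabla2 nabg F X Y Z = g (nabla_endo nabg A X Y) Z &
             g (nabla_endo nabg A X Y) Z =
               3%:R^-1 *: dF X Y Z + 3%:R^-1 *: dF X (A Y) (A Z)
               - 6%:R^-1 *: dF (A X) Y (A Z) - 6%:R^-1 *: dF (A X) (A Y) Z]]).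
Proof.
move=> F G dF; split.
  split=> [[nab [_ einstein skewT]]|skewN].
    exact: (einstein_nijenhuis_skew hA einstein skewT).
  have [nabg lcg] := levi_civita_exists (aph_metric hA).
  exact: (einstein_connection_exists hA lcg skewN).
move=> nab _ einstein skewT X Y Z.
have TE q U V W := einstein_torsion hA einstein skewT q U V W.
have nablag q : nabla2 nab g X Y Z q =
    - (6%:R^-1 * (dF X Y (A Z) q - dF X (A Y) Z q)).
  by rewrite (einstein_nabla2_metric hA einstein skewT) !TE; lra.
have nablaF q : nabla2 nab F X Y Z q =
    6%:R^-1 * (dF X Y Z q *+ 2 - dF X Y (A Z) q - dF X (A Y) Z q).
  by rewrite (einstein_nabla2_kahler hA einstein skewT) !TE; lra.
split.
- by apply: smoothfun_eq => q; rewrite TE.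
- apply: smoothfun_eq => q.
  rewrite (einstein_nabla2_gen_metric hA einstein) sfB !TE.
  rewrite -[RHS]/(3%:R^-1 * (dF X Y Z q - dF X Y (A Z) q)).
  by ring.
- by apply: smoothfun_eq => q; rewrite nablag.
- apply: smoothfun_eq => q; rewrite nablaF -sfMn; exact: erefl.
move=> nabg lcg.
have DE q U V W := difference_formula hA einstein skewT lcg q U V W.
have nabE q : g (nabla_endo nabg A X Y) Z q =
    3%:R^-1 * dF X Y Z q + 3%:R^-1 * dF X (A Y) (A Z) q
    - 6%:R^-1 * dF (A X) Y (A Z) q - 6%:R^-1 * dF (A X) (A Y) Z q.
  exact: (skew_nijenhuis_nabla_endo hA lcg
    (einstein_nijenhuis_skew hA einstein skewT)).
split.
- apply: smoothfun_eq => q.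
  rewrite -[RHS]/(g (nabg X Y) Z q - 6%:R^-1 * dF X Y Z q
    - 6%:R^-1 * dF X (A Y) Z q + 6%:R^-1 * dF (A X) Y Z q).
  by have := DE q X Y Z; rewrite !TE; lra.
- by rewrite (levi_civita_nabla_endo hA lcg).
- by apply: smoothfun_eq => q; rewrite nabE.
Qed.
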